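(* Let $X=\coprod_{n\geq 0}B\Sigma_n$ be the free $E\mathscr{A}_1$-algebra on a point (where $E\mathscr{A}_1$ is the Barratt–Eccles operad), with the map of $E_\infty$-spaces $X\to\mathbb{Z}$ sending $B\Sigma_n$ to $n$, and write $X(n)=B\Sigma_{n-1}$ for $n\geq 1$. Let $\Xi_X$ be the operad associated with $X\to \mathbb{Z}$ (defined in the context). Then there does not exist an $E_\infty$-operad $\mathscr{C}$ together with an operad morphism $$\mathscr{C}\to\Xi_X.$$
   Context: Spaces are compactly generated spaces. Operads are symmetric operads in spaces, indexed by $n\geq1$, $\mathbb{N}=\{1,2,\dots\}$; a morphism of operads is a sequence of $\Sigma_n$-equivariant continuous maps commuting with operadic composition (the operad $\Xi_X$ below is not required to have a unit). An $E_\infty$-operad is an operad $\mathscr{C}$ such that each $\mathscr{C}(n)$ is contractible with free $\Sigma_n$-action. For a set or space $Z$, $EZ$ denotes the (geometric realization of the) Čech resolution, the simplicial space with $(EZ)_p=Z^{p+1}$, faces omitting a coordinate and degeneracies repeating a coordinate. $E$ preserves finite products. The Barratt–Eccles operad is $E\mathscr{A}_1(m)=E\Sigma_m$. The space $X=\coprod_{n\geq0} E\Sigma_n\times_{\Sigma_n}*=\coprod_{n\ge 0} B\Sigma_n$ is an algebra over it, with structure maps $E\Sigma_m\times B\Sigma_{k_1}\times\dots\times B\Sigma_{k_m}\to B\Sigma_{k_1+\dots+k_m}$. The $\mathbb{N}$-sorted operad (multicategory) $\mathscr{M}$: for $m\geq1$ and $\ell_1,\dots,\ell_m,n\geq1$,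 $\mathscr{M}(\ell_1,\dots,\ell_m;n)$ is the set of planar rooted trees with at least one node whose $m$ internal nodes are labelled bijectively by $1,\dots,m$ so that the node labelled $i$ has exactly $\ell_i$ (linearly ordered) successors, and whose $n$ leaves are labelled bijectively by $1,\dots,n$ (it is nonempty exactly when $n=\ell_1+\dots+\ell_m-m+1$). $\Sigma_m$ acts by relabelling nodes. The composition inserts a tree $u\in\mathscr{M}(\ell'_1,\dots,\ell'_{m'};\ell_i)$ in place of the node labelled $i$ of a tree $t\in\mathscr{M}(\ell_1,\dots,\ell_m;n)$, attaching what hung from the $c$-th successor position of that node to the leaf of $u$ labelled $c$, with the nodes renumbered in the standard way. Algebras over $\mathscr{M}$ in spaces are exactly operads in spaces. Let $E\mathscr{M}$ be the $\mathbb{N}$-sorted operad obtained by applying $E$ to each set $\mathscr{M}(\ell_1,\dots,\ell_m;n)$; the inclusion of $0$-simplices is a morphism $\mathscr{M}\to E\mathscr{M}$, so every $E\mathscr{M}$-algebra is, in particular, an operad. Let $\mathscr{D}$ be the $\mathbb{N}$-sorted operad with $\mathscr{D}(\ell_1,\dots,\ell_m;n)=E\Sigma_m$ if $n=\ell_1+\dots+\ell_m-m+1$ and $\emptyset$ otherwise, with composition from the Barratt–Eccles operad. Since $\sum_i(\ell_i-1)=n-1$ in the first case, the $E\mathscr{A}_1$-structure of $X$ makes $(X(n))_{n\in\mathbb{N}}$ a $\mathscr{D}$-algebra, and hence, by projection, a $\mathscr{D}\times E\mathscr{M}$-algebra. For an $\mathbb{N}$-sorted operad $\mathscr{P}$,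 its associated monad on sequences of spaces $Z=(Z(n))_{n\in\mathbb{N}}$ is $$(PZ)(n)=\coprod_{m\geq1}\Big(\coprod_{\ell_1,\dots,\ell_m}\mathscr{P}(\ell_1,\dots,\ell_m;n)\times\prod_{i=1}^m Z(\ell_i)\Big)/\Sigma_m .$$ Let $N$ be the monad associated with $\mathscr{D}\times E\mathscr{M}$ and $EM$ the monad associated with $E\mathscr{M}$; the projection $\mathscr{D}\times E\mathscr{M}\to E\mathscr{M}$ makes $EM$ a right $N$-functor. Then $$\Xi_X:=B\big(EM,N,(X(n))_{n\in\mathbb{N}}\big),$$ the two-sided monadic bar construction (the geometric realization of the simplicial $E\mathscr{M}$-algebra $q\mapsto EM\,N^q\,(X(n))_{n}$). It is an $E\mathscr{M}$-algebra, considered here as an operad via $\mathscr{M}\to E\mathscr{M}$. *)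

(* Defs.v *)
From HB Require Import structures.
From Stdlib Require Import Relation_Operators.
From mathcomp Require Import all_boot all_order all_algebra perm generic_quotient.
From mathcomp Require Import all_classical all_reals.
From mathcomp Require Import topology normedtype.
From mathcomp Require Import ring zify.

Set Implicit Arguments.
Unset Strict Implicit.
Unset Printing Implicit Defensive.

Import Order.TTheory GRing.Theory Num.Theory.
Import numFieldNormedType.Exports.

Local Open Scope classical_set_scope.
Local Open Scope quotient_scope.

Definition kopen (T : topologicalType) (U : set T) : Prop :=
  forall (K : topologicalType) (f : K -> T),
    compact [set: K] -> hausdorff_space K -> continuous f -> open (f @^-1` U).

Definition compactly_generated (T : topologicalType) : Prop :=
  forall U : set T, kopen U -> open U.

(** [T] with the open sets [kopen]. *)
Definition kify (T : Type) : Type := T.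

HB.instance Definition _ (T : choiceType) := Choice.on (kify T).

Section Kify.
Variable T : topologicalType.

Let kopenT : kopen [set: T].
Proof. by move=> K f _ _ _; rewrite preimage_setT; exact: openT. Qed.

Let kopenI : setI_closed (@kopen T).
Proof.
by move=> A B oA oB K f cK hK cf; rewrite preimage_setI; apply: openI; auto.
Qed.

Let kopen_bigU (I : Type) (F : I -> set T) :
  (forall i, kopen (F i)) -> kopen (\bigcup_i F i).
Proof.
move=> oF K f cK hK cf; rewrite preimage_bigcup.
by apply: bigcup_open => i _; exact: oF.
Qed.

HB.instance Definition _ :=
  @isOpenTopological.Build (kify T) (@kopen T) kopenT kopenI kopen_bigU.
End Kify.

(** Products in compactly generated spaces: the product topology, [k]-ified. *)
Definition kpair (T U : topologicalType) : topologicalType := kify (T * U)%type.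

Definition kprod (I : Type) (T : I -> topologicalType) : topologicalType :=
  kify (prod_topology T).

(** The quotient of [T] by the equivalence relation generated by [r]. Maps out of
    such a quotient are defined below on the representative [rpr x]; they do not
    depend on this choice. *)
Section Quot.
Variables (T : topologicalType) (r : T -> T -> Prop).

Definition gen_equiv (x y : T) : bool := `[< clos_refl_sym_trans T r x y >].

Let gen_equiv_refl : reflexive gen_equiv.
Proof. by move=> x; apply/asboolP; exact: rst_refl. Qed.

Let gen_equiv_sym : symmetric gen_equiv.
Proof.
by move=> x y; apply/asboolP/asboolP => xy; exact: rst_sym.
Qed.

Let gen_equiv_trans : transitive gen_equiv.
Proof.
move=> y x z /asboolP xy /asboolP yz; apply/asboolP; exact: rst_trans xy yz.
Qed.

Definition gen_equiv_rel : equiv_rel T :=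
  EquivRel gen_equiv gen_equiv_refl gen_equiv_sym gen_equiv_trans.

Definition quot : topologicalType := quotient_topology {eq_quot gen_equiv_rel}.

Definition cls (x : T) : quot := \pi_(quot)%qT x.
Definition rpr (x : quot) : T := repr x.

Lemma rprK x : cls (rpr x) = x. Proof. exact: reprK. Qed.

Lemma cls_eq x y : r x y -> cls x = cls y.
Proof. by move=> rxy; apply/eqmodP/asboolP; exact: rst_step. Qed.
End Quot.

Section Realization.
Variable R : realType.
Local Open Scope ring_scope.

Definition simplex (p : nat) : topologicalType :=
  set_type [set t : 'rV[R]_p.+1 | (forall i, 0 <= t 0 i) /\ \sum_i t 0 i = 1].

Lemma simplex_ge0 p (t : simplex p) i : 0 <= \val t 0 i.
Proof. by have [+ _] := set_valP t; exact. Qed.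

Lemma simplex_sum p (t : simplex p) : \sum_i \val t 0 i = 1.
Proof. by have [_] := set_valP t. Qed.

Definition push_row p q (f : 'I_p.+1 -> 'I_q.+1) (t : 'rV[R]_p.+1) :
  'rV[R]_q.+1 := \row_j \sum_(k | f k == j) t 0 k.

Lemma push_subproof p q (f : 'I_p.+1 -> 'I_q.+1) (t : simplex p) :
  push_row f (\val t) \in
    [set t : 'rV[R]_q.+1 | (forall i, 0 <= t 0 i) /\ \sum_i t 0 i = 1].
Proof.
rewrite inE /=; split.
  by move=> i; rewrite mxE; apply: sumr_ge0 => k _; exact: simplex_ge0.
under eq_bigr do rewrite mxE.
by rewrite -[RHS](simplex_sum t) [RHS](partition_big f xpredT).
Qed.

(** The affine map of simplices induced by a map of vertices. *)
Definition push p q (f : 'I_p.+1 -> 'I_q.+1) (t : simplex p) : simplex q :=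
  @exist _ (fun x => x \in _) _ (push_subproof f t).

(** Only the data of a simplicial space: its realization does not involve the
    simplicial identities. *)
Record sspace := SSpace {
  sp :> nat -> topologicalType;
  face : forall p, 'I_p.+2 -> sp p.+1 -> sp p;
  degen : forall p, 'I_p.+1 -> sp p -> sp p.+1 }.

Definition coface p (i : 'I_p.+2) : 'I_p.+1 -> 'I_p.+2 := lift i.
Definition codegen p (i : 'I_p.+1) : 'I_p.+2 -> 'I_p.+1 :=
  fun k => inord (unbump i k).

Definition cells (A : sspace) : topologicalType :=
  {p : nat & kpair (A p) (simplex p)}.

Definition cell (A : sspace) p (a : A p) (t : simplex p) : cells A :=
  existT _ p (a, t).

Inductive glued (A : sspace) : cells A -> cells A -> Prop :=
| GlueFace p (i : 'I_p.+2) (a : A p.+1) (t : simplex p) :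
    glued (cell a (push (coface i) t)) (cell (face i a) t)
| GlueDegen p (i : 'I_p.+1) (a : A p) (t : simplex p.+1) :
    glued (cell a (push (codegen i) t)) (cell (degen i a) t).

Definition realize (A : sspace) : topologicalType := quot (@glued A).

Definition realize_map (A B : sspace) (f : forall p, A p -> B p)
    (x : realize A) : realize B :=
  let: existT p (a, t) := rpr x in cls (@glued B) (cell (f p a) t).

Definition sprod (J : Type) (A : J -> sspace) : sspace := {|
  sp p := kprod (fun j => A j p);
  face p i a := fun j => face i (a j);
  degen p i a := fun j => degen i (a j) |}.

(** The canonical map from the realization of a finite product to the product
    of the realizations is onto: finitely many points of simplices have a common
    subdivision. *)
Section CommonSubdivision.

Inductive mrg : seq R -> seq R -> Prop :=
| MrgRefl s : mrg s s
| MrgStep l1 u v l2 s : mrg (l1 ++ (u + v) :: l2) s ->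
    mrg (l1 ++ u :: v :: l2) s.

Lemma mrg_trans r s t : mrg r s -> mrg s t -> mrg r t.
Proof. by elim=> // *; apply: MrgStep; auto. Qed.

Lemma mrg_cons a r s : mrg r s -> mrg (a :: r) (a :: s).
Proof.
elim=> [|l1 u v l2 s' _ IH]; first by move=> ?; exact: MrgRefl.
exact: (@MrgStep (a :: l1)).
Qed.

Lemma mrg_sum u r : mrg (u :: r) [:: \sum_(x <- u :: r) x].
Proof.
elim: r u => [|v r IH] u; first by rewrite big_seq1; exact: MrgRefl.
apply: (@MrgStep [::]) => /=.
have -> : \sum_(x <- [:: u, v & r]) x = \sum_(x <- u + v :: r) x.
  by rewrite !big_cons addrA.
exact: IH.
Qed.

Definition nng (s : seq R) := all (fun x => 0 <= x) s.

Lemma mrg2 N s t : (size s + size t <= N)%N -> nng s -> nng t ->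
  s != [::] -> t != [::] -> \sum_(x <- s) x = \sum_(x <- t) x ->
  exists r, [/\ nng r, mrg r s & mrg r t].
Proof.
elim: N s t => [|N IH] [|a [|a' s]] [|b [|b' t]] //= + + + _ _.
- move=> _ /andP[a0 _] /andP[b0 _]; rewrite !big_seq1 => <-.
  by exists [:: a]; split; [rewrite /nng/= a0| exact: MrgRefl | exact: MrgRefl].
- move=> _ _ h; rewrite big_seq1 => ->; exists (b :: b' :: t).
  by split => //; [exact: mrg_sum|exact: MrgRefl].
- move=> _ h _; rewrite big_seq1 => <-; exists (a :: a' :: s).
  by split => //; [exact: MrgRefl|exact: mrg_sum].
move=> sz /and3P[a0 a'0 s0] /and3P[b0 b'0 t0] e.
have [ab|/ltW ba] := leP a b.
- have [||||||r [r0 rs rt]] := IH (a' :: s) [:: b - a, b' & t].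
  + by move: sz; rewrite /= !addSn !addnS !ltnS.
  + by rewrite /nng /= a'0.
  + by rewrite /nng /= subr_ge0 ab b'0.
  + by [].
  + by [].
  + move: e; rewrite !big_cons => e; apply: (@addrI _ a); rewrite e; ring.
  exists (a :: r); split; first by rewrite /nng /= a0.
    exact: mrg_cons.
  apply: mrg_trans (mrg_cons _ rt) _; apply: (@MrgStep [::]) => /=.
  by rewrite addrC subrK; exact: MrgRefl.
- have [||||||r [r0 rs rt]] := IH [:: a - b, a' & s] (b' :: t).
  + by move: sz; rewrite /= !addSn !addnS !ltnS.
  + by rewrite /nng /= subr_ge0 ba a'0.
  + by rewrite /nng /= b'0.
  + by [].
  + by [].
  + move: e; rewrite !big_cons => e; apply: (@addrI _ b); rewrite -e; ring.
  exists (b :: r); split; first by rewrite /nng /= b0.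
    apply: mrg_trans (mrg_cons _ rs) _; apply: (@MrgStep [::]) => /=.
    by rewrite addrC subrK; exact: MrgRefl.
  exact: mrg_cons.
Qed.

Definition coords p (t : simplex p) : seq R := [seq \val t 0 i | i : 'I_p.+1].

Lemma coords_nng p (t : simplex p) : nng (coords t).
Proof. by apply/allP => x /mapP[i _ ->]; exact: simplex_ge0. Qed.

Lemma coords_sum p (t : simplex p) : \sum_(x <- coords t) x = 1.
Proof. by rewrite big_image /= simplex_sum. Qed.

Lemma size_coords p (t : simplex p) : size (coords t) = p.+1.
Proof. by rewrite size_image card_ord. Qed.

Lemma nth_coords p (t : simplex p) (i : 'I_p.+1) : (coords t)`_i = \val t 0 i.
Proof. by rewrite (nth_map i) ?size_enum_ord// nth_ord_enum. Qed.

Lemma coords_inj p (t t' : simplex p) : coords t = coords t' -> t = t'.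
Proof.
by move=> tt'; apply/val_inj/rowP => i; rewrite -!nth_coords tt'.
Qed.

Lemma coords_ex r : nng r -> \sum_(x <- r) x = 1 ->
  exists q (t : simplex q), coords t = r.
Proof.
case: r => [_|x r r0 r1]; first by rewrite big_nil => /esym/eqP; rewrite oner_eq0.
pose v := \row_(i < (size r).+1) (x :: r)`_i.
have vP : v \in [set t : 'rV[R]__ | (forall i, 0 <= t 0 i) /\ \sum_i t 0 i = 1].
  rewrite inE /=; split.
    by move=> i; rewrite mxE; apply: (allP r0); exact: mem_nth.
  under eq_bigr do rewrite mxE.
  by move: r1; rewrite (big_nth 0) big_mkord.
exists (size r), (@exist _ (fun x => x \in _) _ vP).
apply: (@eq_from_nth _ 0) => [|i]; rewrite size_coords// => ltir.
by rewrite (nth_coords _ (Ordinal ltir)) mxE.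
Qed.

Lemma push_codegen p (i : 'I_p.+1) (t' : simplex p.+1) (t : simplex p)
    l1 u v l2 : size l1 = i ->
  coords t' = l1 ++ u :: v :: l2 -> coords t = l1 ++ (u + v) :: l2 ->
  push (codegen i) t' = t.
Proof.
move=> si t'E tE; apply/val_inj/rowP => j; rewrite mxE -nth_coords tE.
have cg k : codegen i k = unbump i k :> nat.
  rewrite inordK //; have := ltn_ord i; have := ltn_ord k.
  by rewrite /unbump; case: (ltnP i k); lia.
have cge (k : 'I_p.+2) (m : 'I_p.+1) :
  (codegen i k == m) = (unbump i k == m)%N by rewrite -cg val_eqE.
under eq_bigr do rewrite -nth_coords t'E.
have [ji|ij|ji] := ltngtP j i.
- have ltj : (j < p.+2)%N by exact: ltn_trans (ltn_ord j) _.
  rewrite (big_pred1 (Ordinal ltj)) => [|k]; first by rewrite !nth_cat si /= ji.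
  by rewrite /= cge -val_eqE /= /unbump; case: (ltnP i k); lia.
- have ltj : (j.+1 < p.+2)%N by exact: ltn_ord j.
  rewrite (big_pred1 (Ordinal ltj)) => [|k].
    rewrite !nth_cat si /= (ltnNge j) (ltnW ij) ltnNge ltnW//= 1?ltnW//.
    have -> : (j - i = (j - i).-1.+1)%N by lia.
    by have -> : (j.+1 - i = (j - i).-1.+2)%N by lia.
  by rewrite /= cge -val_eqE /= /unbump; case: (ltnP i k); lia.
- have lti : (i < p.+2)%N by exact: ltn_trans (ltn_ord i) _.
  have lti1 : (i.+1 < p.+2)%N by exact: ltn_ord i.
  rewrite (bigD1 (Ordinal lti)) /=; last first.
    by rewrite cge /= ji /unbump ltnn subn0.
  rewrite (big_pred1 (Ordinal lti1)) => [|k]; last first.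
    by rewrite /= cge -!val_eqE /= ji /unbump; case: (ltnP i k); lia.
  rewrite !nth_cat si /= ji !ltnn subnn /= (ltnNge i.+1) leqnSn /=.
  by rewrite subSnn.
Qed.

Lemma mrg_cell (A : sspace) p (a : A p) (t : simplex p) r :
  mrg r (coords t) -> nng r ->
  exists q (a' : A q) (t' : simplex q),
    coords t' = r /\ cls (@glued A) (cell a t) = cls (@glued A) (cell a' t').
Proof.
move ts : (coords t) => s m; elim: m ts => [s' <- _|l1 u v l2 s' m IH sE r0].
  by exists p, a, t.
have m0 : nng (l1 ++ (u + v) :: l2).
  move: r0; rewrite /nng !all_cat /= => /and4P[-> u0 v0 ->].
  by rewrite addr_ge0.
have [q [a' [t' [t'E ->]]]] := IH sE m0.
have [|q' [t'' t''E]] := coords_ex r0.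
  rewrite -(coords_sum t') t'E !big_cat /= !big_cons; ring.
have q'E : q' = q.+1.
  have := size_coords t''; have := size_coords t'.
  by rewrite t'E t''E !size_cat /=; lia.
move: t'' t''E; rewrite {}q'E => t'' t''E.
have lti : (size l1 < q.+1)%N.
  by have := size_coords t'; rewrite t'E size_cat /=; lia.
exists q.+1, (degen (Ordinal lti) a'), t''; split=> //.
rewrite -(@push_codegen _ (Ordinal lti) t'' t' l1 u v l2) //.
by apply: cls_eq; exact: GlueDegen.
Qed.

Lemma common_subdivision (J : finType) (p : J -> nat)
    (t : forall j, simplex (p j)) :
  exists r, [/\ nng r, \sum_(x <- r) x = 1 & forall j, mrg r (coords (t j))].
Proof.
suff [r [r0 r1 rP]] : exists r, [/\ nng r, \sum_(x <- r) x = 1 &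
    forall j, j \in enum J -> mrg r (coords (t j))].
  by exists r; split => // j; apply: rP; rewrite mem_enum.
elim: (enum J) => [|j s [r [r0 r1 rs]]].
  by exists [:: 1]; split => //; [rewrite /nng /= ler01|rewrite big_seq1].
have sum_mrg (x y : seq R) : mrg x y -> \sum_(z <- x) z = \sum_(z <- y) z.
  elim=> // l1 u v l2 s' _ <-; rewrite !big_cat /= !big_cons; ring.
have [||||||r' [r'0 r'r r't]] :=
  @mrg2 (size r + size (coords (t j))) r (coords (t j)).
- by [].
- by [].
- exact: coords_nng.
- by apply: contra_eq_neq r1 => ->; rewrite big_nil eq_sym oner_eq0.
- by rewrite -size_eq0 size_coords.
- by rewrite coords_sum.
exists r'; split => //; first by rewrite (sum_mrg _ _ r'r).
move=> k; rewrite inE => /predU1P[->//|ks]; exact: mrg_trans r'r (rs _ ks).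
Qed.

Lemma realize_map_cls (A B : sspace) (f : forall p, A p -> B p) p (a : A p) t :
  (forall p (i : 'I_p.+2) a, f p (face i a) = face i (f p.+1 a)) ->
  (forall p (i : 'I_p.+1) a, f p.+1 (degen i a) = degen i (f p a)) ->
  realize_map f (cls (@glued A) (cell a t)) = cls (@glued B) (cell (f p a) t).
Proof.
move=> fF fD; pose F (c : cells A) : realize B :=
  let: existT p (a, t) := c in cls (@glued B) (cell (f p a) t).
rewrite /realize_map -/(F (rpr _)) -[RHS]/(F (cell a t)).
suff FE c c' : cls (@glued A) c = cls (@glued A) c' -> F c = F c'.
  by apply: FE; exact: rprK.
move=> /eqmodP/asboolP.
elim=> [x y [q i b u|q i b u]|x|x y _ ->|x y z _ -> _ ->] //=.
- by rewrite fF; apply: cls_eq; exact: GlueFace.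
- by rewrite fD; apply: cls_eq; exact: GlueDegen.
Qed.

Lemma rprod_onto (J : finType) (A : J -> sspace) (x : forall j, realize (A j)) :
  exists z : realize (sprod A),
    forall j, realize_map (fun p (a : sprod A p) => a j) z = x j.
Proof.
pose p j := tag (rpr (x j)).
pose a j : A j (p j) := (tagged (rpr (x j))).1.
pose t j : simplex (p j) := (tagged (rpr (x j))).2.
have xE j : x j = cls (@glued (A j)) (cell (a j) (t j)).
  by rewrite -[LHS]rprK /cell /a /t /p; case: (rpr (x j)) => ? [].
have [r [r0 r1 rt]] := common_subdivision t.
have [q [u uE]] := coords_ex r0 r1.
have aP j : exists b : A j q, x j = cls (@glued (A j)) (cell b u).
  have [q' [b [u' [u'E bE]]]] := mrg_cell (a j) (rt j) r0.
  have q'q : q' = q by apply: succn_inj; rewrite -(size_coords u) -(size_coords u') uE u'E.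
  move: b u' u'E bE; rewrite {}q'q => b u' u'E bE.
  by exists b; rewrite xE bE; congr (cls _ (cell _ _)); apply: coords_inj; rewrite uE.
pose b j := sval (cid (aP j)).
exists (cls (@glued (sprod A)) (cell (b : sprod A q) u)) => j.
by rewrite realize_map_cls // [RHS](svalP (cid (aP j))).
Qed.

End CommonSubdivision.

(** The inverse of the canonical homeomorphism
    [|prod_j A j| -> prod_j |A j|]. *)
Definition rprod_inv (J : finType) (A : J -> sspace)
    (x : forall j, realize (A j)) : realize (sprod A) :=
  sval (cid (rprod_onto x)).

End Realization.

Section Cech.
Variable R : realType.

Definition cech (Z : choiceType) : sspace := {|
  sp p := discrete_topology {ffun 'I_p.+1 -> Z};
  face p i z := [ffun k => z (coface i k)];
  degen p i z := [ffun k => z (codegen i k)] |}.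

Definition E (Z : choiceType) : topologicalType := realize R (cech Z).

Definition Emap (Z W : choiceType) (f : Z -> W) : E Z -> E W :=
  @realize_map R (cech Z) (cech W) (fun p z => [ffun k => f (z k)]).

(** [E] of a map out of a finite product, precomposed with
    [prod_j E (Z j) = E (prod_j Z j)]. *)
Definition Emulti (J : finType) (Z : J -> choiceType) (W : choiceType)
    (g : (forall j, Z j) -> W) (x : forall j, E (Z j)) : E W :=
  @realize_map R (sprod (fun j => cech (Z j))) (cech W)
    (fun p (z : forall j, {ffun 'I_p.+1 -> Z j}) => [ffun k => g (fun j => z j k)])
    (rprod_inv x).

Definition vertex0 : simplex R 0.
Proof.
apply: (@exist _ (fun x => x \in _) (const_mx 1%R)).
rewrite inE /=; split=> [i|]; first by rewrite mxE ler01.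
by rewrite big_ord1 mxE.
Defined.

Definition Evertex (Z : choiceType) (z : Z) : E Z :=
  cls (@glued R (cech Z)) (cell (A := cech Z) (p := 0) [ffun=> z] vertex0).
End Cech.

(** The data of an operad with set of sorts [{1, 2, 3, ...}], in sets or in
    spaces. The sort [n >= 1] is encoded by the natural number [n.-1] throughout,
    and likewise the arity-[n] part of an operad is indexed by [n.-1].
    [so_comp] composes at all inputs at once and renumbers them in the
    lexicographic order of the pairs [(i, c)] with [c < k i]. *)
Record soperad (C : Type) (el : C -> Type) := SOperad {
  so : forall m, ('I_m -> nat) -> nat -> C;
  so_act : forall m (l : 'I_m -> nat) n (s : 'S_m),
    el (so l n) -> el (so (fun i => l (s i)) n);
  so_one : forall n, el (so (fun _ : 'I_1 => n) n);
  so_comp : forall m (l : 'I_m -> nat) n (k : 'I_m -> nat)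
      (l' : forall i, 'I_(k i) -> nat),
    el (so l n) -> (forall i, el (so (l' i) (l i))) ->
    el (so (fun j : 'I_(\sum_i k i) => l' (tagnat.sig1 j) (tagnat.sig2 j)) n) }.

Definition set_soperad := soperad Choice.sort.
Definition top_soperad := soperad Topological.sort.

Section SortedOperads.
Variable R : realType.

Definition Esoperad (P : set_soperad) : top_soperad := {|
  so m l n := E R (so P l n);
  so_act m l n s := Emap (so_act s);
  so_one n := Evertex R (so_one P n);
  so_comp m l n k l' p q :=
    let Z (o : option 'I_m) : choiceType :=
      if o is Some i then so P (l' i) (l i) else so P l n in
    @Emulti R _ Z _ (fun z => so_comp (z None) (fun i => z (Some i)))
      (fun o => match o return E R (Z o) with None => p | Some i => q i end) |}.

Definition prod_soperad (P Q : top_soperad) : top_soperad := {|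
  so m l n := kpair (so P l n) (so Q l n);
  so_act m l n s x := (so_act s x.1, so_act s x.2);
  so_one n := (so_one P n, so_one Q n);
  so_comp m l n k l' x y :=
    (so_comp x.1 (fun i => (y i).1), so_comp x.2 (fun i => (y i).2)) |}.

Section Monad.
Variable P : top_soperad.
Implicit Types Z W : nat -> topologicalType.

Definition word Z n m : topologicalType :=
  {l : 'I_m -> nat & kpair (so P l n) (kprod (fun i => Z (l i)))}.

Definition mkword Z n m (l : 'I_m -> nat) (p : so P l n)
  (z : forall i, Z (l i)) : word Z n m := existT _ l (p, z).

Inductive reorder Z n m : word Z n m -> word Z n m -> Prop :=
| Reorder (l : 'I_m -> nat) (p : so P l n) (z : forall i, Z (l i)) (s : 'S_m) :
    reorder (mkword p z) (mkword (so_act s p) (fun i => z (s i))).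

Definition posn := {m : nat | (0 < m)%N}.

Definition monad Z n : topologicalType :=
  {m : posn & quot (@reorder Z n (sval m))}.

Definition mcls Z n (m : posn) (l : 'I_(sval m) -> nat) (p : so P l n)
  (z : forall i, Z (l i)) : monad Z n := existT _ m (cls _ (mkword p z)).

Definition mmap Z W (f : forall n, Z n -> W n) n (x : monad Z n) : monad W n :=
  let: existT l (p, z) := rpr (tagged x) in
  mcls p (fun i => f _ (z i)).

Definition posn1 : posn := exist _ 1%N isT.

Definition munit Z n (z : Z n) : monad Z n :=
  @mcls Z n posn1 (fun=> n) (so_one P n) (fun=> z).

Lemma posn_sum_subproof (m : posn) (k : 'I_(sval m) -> posn) :
  (0 < \sum_i sval (k i))%N.
Proof.
case: m k => -[//|m] m0 k; rewrite big_ord_recl.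
by apply: ltn_addr; exact: (svalP (k ord0)).
Qed.

Definition posn_sum (m : posn) (k : 'I_(sval m) -> posn) : posn :=
  @exist _ (fun m => (0 < m)%N) _ (posn_sum_subproof k).

Definition mmul Z n (x : monad (monad Z) n) : monad Z n :=
  let: existT l (p, y) := rpr (tagged x) in
  let k i := tag (y i) in
  let w i : word Z (l i) (sval (k i)) := rpr (tagged (y i)) in
  @mcls Z n (posn_sum k) _ (so_comp p (fun i => (tagged (w i)).1))
    (fun j => (tagged (w (tagnat.sig1 j))).2 (tagnat.sig2 j)).

Definition malg Z
    (theta : forall (m : posn) (l : 'I_(sval m) -> nat) n,
      so P l n -> (forall i, Z (l i)) -> Z n)
    n (x : monad Z n) : Z n :=
  let: existT l (p, z) := rpr (tagged x) in theta _ l n p z.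

End Monad.
End SortedOperads.

Lemma sum_permV m (k : 'I_m -> nat) (s : 'S_m) :
  (\sum_i k (s^-1%g i) = \sum_i k i)%N.
Proof.
by rewrite [LHS](reindex_inj (@perm_inj _ s)); apply: eq_bigr => i _; rewrite permK.
Qed.

(** A permutation [s] sends an input to its position, so the [c]-th input of the
    [i]-th block goes to the position [t i c] of the block in position [s i]. *)
Definition block_comp_fun m (s : 'S_m) (k : 'I_m -> nat)
    (t : forall i, 'S_(k i)) (j : 'I_(\sum_i k i)) : 'I_(\sum_i k i) :=
  let i := tagnat.sig1 j in
  cast_ord (sum_permV k s)
    (tagnat.Rank (s i)
       (cast_ord (congr1 k (esym (permK s i))) (t i (tagnat.sig2 j)))).

Lemma block_comp_inj m (s : 'S_m) (k : 'I_m -> nat) (t : forall i, 'S_(k i)) :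
  injective (block_comp_fun s t).
Proof.
move=> j j' /(congr1 val) /= /eqP; rewrite tagnat.eq_Rank => /andP[/eqP/perm_inj].
rewrite -[j]tagnat.sigK -[j']tagnat.sigK /tagnat.sig1 /tagnat.sig2 !tagnat.rankK.
case: (tagnat.sig j) (tagnat.sig j') => i c [i' c'] /= ii'.
by subst i' => /eqP /= /val_inj/perm_inj ->.
Qed.

Definition block_comp m (s : 'S_m) (k : 'I_m -> nat) (t : forall i, 'S_(k i)) :
  'S_(\sum_i k i) := perm (@block_comp_inj m s k t).

Section BarrattEccles.
Variable R : realType.

Definition be_comp m (k : 'I_m -> nat) (e : E R 'S_m)
    (f : forall i, E R 'S_(k i)) : E R 'S_(\sum_i k i) :=
  let Z (o : option 'I_m) : choiceType :=
    if o is Some i then 'S_(k i) else 'S_m in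
  @Emulti R _ Z _ (fun z => block_comp (z None) (fun i => z (Some i)))
    (fun o => match o return E R (Z o) with None => e | Some i => f i end).

Inductive symrel n : E R 'S_n -> E R 'S_n -> Prop :=
| Symrel (x : E R 'S_n) (s : 'S_n) :
    symrel x (Emap (fun u : 'S_n => (s * u)%g) x).

Definition BSym n : topologicalType := quot (@symrel n).

Definition BSym_act m (k : 'I_m -> nat) (e : E R 'S_m)
    (x : forall i, BSym (k i)) : BSym (\sum_i k i) :=
  cls _ (be_comp e (fun i => rpr (x i))).
End BarrattEccles.

(** The sets, [Sigma_m] or empty, to which [E] is applied to get the sorted
    operad [D]; as sorts are shifted by one, [n = l_1 + ... + l_m - m + 1] reads
    [n = \sum_i l i]. *)
Definition Dset m (l : 'I_m -> nat) n : choiceType :=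
  {s : 'S_m | n == \sum_i l i}.

Lemma Dset_act_subproof m (l : 'I_m -> nat) n (s : 'S_m) :
  n == \sum_i l i -> n == \sum_i l (s i).
Proof. by rewrite [X in n == X -> _](reindex_inj (@perm_inj _ s)). Qed.

Lemma Dset_one_subproof n : n == \sum_(i < 1) n.
Proof. by rewrite big_ord1. Qed.

Lemma sum_tagnat m (k : 'I_m -> nat) (F : forall i, 'I_(k i) -> nat) :
  (\sum_j F (tagnat.sig1 j) (tagnat.sig2 j) = \sum_i \sum_c F i c)%N.
Proof.
rewrite sig_big_dep /= (reindex _ (@tagnat.sig_bij_on _ k)) /=.
by apply: eq_bigr.
Qed.

Lemma Dset_comp_subproof m (l : 'I_m -> nat) n (k : 'I_m -> nat)
    (l' : forall i, 'I_(k i) -> nat) :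
  n == \sum_i l i -> (forall i, l i == \sum_c l' i c) ->
  n == \sum_(j < \sum_i k i) l' (tagnat.sig1 j) (tagnat.sig2 j).
Proof.
move=> /eqP-> h; rewrite sum_tagnat; apply/eqP/eq_bigr => i _; exact/eqP.
Qed.

Definition Dset_soperad : set_soperad := {|
  so := Dset;
  so_act m l n s u := exist _ (s * sval u)%g (Dset_act_subproof s (svalP u));
  so_one n := exist _ 1%g (Dset_one_subproof n);
  so_comp m l n k l' u v :=
    exist _ (block_comp (sval u) (fun i => sval (v i)))
      (Dset_comp_subproof (svalP u) (fun i => svalP (v i))) |}.

Section DAlgebra.
Variable R : realType.

Definition Esupport (Z : choiceType) (x : E R Z) : Z :=
  (tagged (rpr x)).1 ord0.

Definition Dtheta m (l : 'I_m -> nat) n (d : so (Esoperad R Dset_soperad) l n)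
    (x : forall i, BSym R (l i)) : BSym R n :=
  ecast n (BSym R n) (esym (eqP (svalP (Esupport d))))
    (BSym_act (Emap sval d) x).
End DAlgebra.

Inductive tree (I : Type) (ar : I -> nat) (L : Type) :=
| Leaf (l : L)
| Node (i : I) (ts : 'I_(ar i).+1 -> tree ar L).

Arguments Leaf {I ar L}.
Arguments Node {I ar L}.

HB.instance Definition _ (I : Type) (ar : I -> nat) (L : Type) :=
  gen_eqMixin (tree ar L).
HB.instance Definition _ (I : Type) (ar : I -> nat) (L : Type) :=
  gen_choiceMixin (tree ar L).

Section Trees.
Local Open Scope nat_scope.

Fixpoint node_count I (ar : I -> nat) L (a : pred I) (t : tree ar L) : nat :=
  if t is Node i ts then a i + \sum_c node_count a (ts c) else 0.

Fixpoint leaf_count I (ar : I -> nat) L (a : pred L) (t : tree ar L) : nat :=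
  match t with Leaf l => a l | Node i ts => \sum_c leaf_count a (ts c) end.

Definition bijectively_labelled m (ar : 'I_m -> nat) n (t : tree ar 'I_n) :=
  [forall i, node_count (pred1 i) t == 1] &&
  [forall l, leaf_count (pred1 l) t == 1].

Fixpoint tree_bind I (ar : I -> nat) L L' (f : L -> tree ar L') (t : tree ar L) :
  tree ar L' :=
  match t with
  | Leaf l => f l
  | Node i ts => Node i (fun c => tree_bind f (ts c))
  end.

Fixpoint relabel I J (ar : I -> nat) (ar' : J -> nat) L (f : I -> J)
    (e : forall i, ar' (f i) = ar i) (t : tree ar L) : tree ar' L :=
  match t with
  | Leaf l => Leaf l
  | Node i ts =>
      Node (f i) (fun c => relabel e (ts (cast_ord (congr1 S (e i)) c)))
  end.

(** Insert [u i] in place of the node [i]. *)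
Fixpoint tree_subst I J (ar : I -> nat) (ar' : J -> nat) L
    (u : forall i, tree ar' 'I_(ar i).+1) (t : tree ar L) : tree ar' L :=
  match t with
  | Leaf l => Leaf l
  | Node i ts => tree_bind (fun c => tree_subst u (ts c)) (u i)
  end.

Lemma node_count_relabel I J (ar : I -> nat) (ar' : J -> nat) L (f : I -> J)
    (e : forall i, ar' (f i) = ar i) a (t : tree ar L) :
  node_count a (relabel e t) = node_count (fun i => a (f i)) t.
Proof.
elim: t => //= i ts IH; congr (_ + _).
rewrite (reindex (cast_ord (esym (congr1 S (e i))))) /=; last first.
  apply: onW_bij; exists (cast_ord (congr1 S (e i))).
    exact: cast_ordKV.
  exact: cast_ordK.
by apply: eq_bigr => c _; rewrite cast_ordKV IH.
Qed.

Lemma leaf_count_relabel I J (ar : I -> nat) (ar' : J -> nat) L (f : I -> J)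
    (e : forall i, ar' (f i) = ar i) a (t : tree ar L) :
  leaf_count a (relabel e t) = leaf_count a t.
Proof.
elim: t => //= i ts IH.
rewrite (reindex (cast_ord (esym (congr1 S (e i))))) /=; last first.
  apply: onW_bij; exists (cast_ord (congr1 S (e i))).
    exact: cast_ordKV.
  exact: cast_ordK.
by apply: eq_bigr => c _; rewrite cast_ordKV IH.
Qed.

Lemma eq_node_count I (ar : I -> nat) L (a b : pred I) (t : tree ar L) :
  a =1 b -> node_count a t = node_count b t.
Proof.
move=> ab; elim: t => //= i ts IH; rewrite ab; congr (_ + _).
by apply: eq_bigr => c _; exact: IH.
Qed.

Lemma sum_delta m (i : 'I_m) (F : 'I_m -> nat) : \sum_j (i == j) * F j = F i.
Proof.
rewrite (bigD1 i) //= eqxx mul1n big1 ?addn0// => j ji.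
by rewrite eq_sym (negPf ji).
Qed.

Lemma node_count_sum m (ar : 'I_m -> nat) L (a : pred 'I_m) (t : tree ar L) :
  node_count a t = \sum_i a i * node_count (pred1 i) t.
Proof.
elim: t => [l|i ts IH] /=; first by rewrite big1 // => i _; rewrite muln0.
under [RHS]eq_bigr do rewrite mulnDr.
rewrite big_split /= (eq_bigr (fun j => (i == j) * a j)) => [|j _]; last first.
  by rewrite mulnC.
rewrite sum_delta.
congr (_ + _); under eq_bigr do rewrite IH.
by rewrite exchange_big /=; apply: eq_bigr => j _; rewrite big_distrr.
Qed.

Lemma leaf_count_bind I (ar : I -> nat) n L' (f : 'I_n -> tree ar L') a
    (t : tree ar 'I_n) :
  leaf_count a (tree_bind f t) =
  \sum_c leaf_count (pred1 c) t * leaf_count a (f c).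
Proof.
elim: t => [l|i ts IH] /=; first by rewrite sum_delta.
under eq_bigr do rewrite IH.
by rewrite exchange_big; apply: eq_bigr => c _; rewrite big_distrl.
Qed.

Lemma node_count_bind I (ar : I -> nat) n L' (f : 'I_n -> tree ar L') a
    (t : tree ar 'I_n) :
  node_count a (tree_bind f t) =
  node_count a t + \sum_c leaf_count (pred1 c) t * node_count a (f c).
Proof.
elim: t => [l|i ts IH] /=; first by rewrite sum_delta.
under eq_bigr do rewrite IH.
rewrite big_split /= addnA; congr (_ + _).
by rewrite exchange_big; apply: eq_bigr => c _; rewrite big_distrl.
Qed.

Section CountSubst.
Variables (m : nat) (J : Type) (ar : 'I_m -> nat) (ar' : J -> nat) (L : Type).
Variable u : forall i, tree ar' 'I_(ar i).+1.
Hypothesis u1 : forall i c, leaf_count (pred1 c) (u i) = 1.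

Lemma leaf_count_subst a (t : tree ar L) :
  leaf_count a (tree_subst u t) = leaf_count a t.
Proof.
elim: t => //= i ts IH; rewrite leaf_count_bind.
by apply: eq_bigr => c _; rewrite u1 mul1n IH.
Qed.

Lemma node_count_subst a (t : tree ar L) :
  node_count a (tree_subst u t) =
  \sum_i node_count (pred1 i) t * node_count a (u i).
Proof.
elim: t => [l|i ts IH] /=; first by rewrite big1.
under [RHS]eq_bigr do rewrite mulnDl.
rewrite node_count_bind big_split /=; congr (_ + _).
  by rewrite sum_delta.
under eq_bigr do rewrite u1 mul1n IH.
by rewrite exchange_big; apply: eq_bigr => c _; rewrite big_distrl.
Qed.
End CountSubst.

Lemma bijectively_labelledP m (ar : 'I_m -> nat) n (t : tree ar 'I_n) :
  reflect ((forall i, node_count (pred1 i) t = 1) /\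
           (forall l, leaf_count (pred1 l) t = 1))
    (bijectively_labelled t).
Proof.
apply: (iffP andP) => -[h h']; split.
- by move=> i; apply/eqP/(forallP h).
- by move=> i; apply/eqP/(forallP h').
- by apply/forallP => i; rewrite h.
- by apply/forallP => i; rewrite h'.
Qed.

(** Sorts are shifted by one: the node [i] has [(l i).+1] successors, and there
    are [n.+1] leaves. Only [m > 0] matters, and such a tree has a node. *)
Definition Mset m (l : 'I_m -> nat) n : choiceType :=
  {t : tree l 'I_n.+1 | bijectively_labelled t}.

Definition MTree m (l : 'I_m -> nat) n (t : tree l 'I_n.+1)
    (tP : bijectively_labelled t) : Mset l n :=
  @exist _ (fun t => bijectively_labelled t) t tP.

Lemma Mset_act_subproof m (l : 'I_m -> nat) n (s : 'S_m)
    (t : tree l 'I_n.+1) : bijectively_labelled t ->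
  bijectively_labelled
    (relabel (ar' := fun i => l (s i)) (f := fun i => s^-1 i)%g
       (fun i => congr1 l (permKV s i)) t).
Proof.
move=> /bijectively_labelledP[t1 t2]; apply/bijectively_labelledP; split => i.
  rewrite node_count_relabel -(t1 (s i)); apply: eq_node_count => j /=.
  by rewrite (canF_eq (permKV s)).
by rewrite leaf_count_relabel.
Qed.

Lemma Mset_one_subproof n (s : 'S_n.+1) :
  bijectively_labelled
    (Node (ar := fun _ : 'I_1 => n) ord0 (fun c => Leaf (s c))).
Proof.
apply/bijectively_labelledP; split=> [i|l] /=.
  by rewrite big1 // [i]ord1.
rewrite (bigD1 (s^-1 l)%g) //= permKV eqxx big1 ?addn0// => c.
by apply: contraNeq; rewrite eqb0 negbK => /eqP <-; rewrite permK.
Qed.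

Lemma Mset_comp_subproof m (l : 'I_m -> nat) n (k : 'I_m -> nat)
    (l' : forall i, 'I_(k i) -> nat) (t : tree l 'I_n.+1)
    (u : forall i, tree (l' i) 'I_(l i).+1)
    (e : forall i c, l' (tagnat.sig1 (tagnat.Rank i c))
                        (tagnat.sig2 (tagnat.Rank i c)) = l' i c) :
  bijectively_labelled t -> (forall i, bijectively_labelled (u i)) ->
  bijectively_labelled
    (tree_subst (ar' := fun j => l' (tagnat.sig1 j) (tagnat.sig2 j))
       (fun i => relabel (f := fun c => tagnat.Rank i c) (e i) (u i)) t).
Proof.
move=> /bijectively_labelledP[t1 t2] uP.
have u1 i : forall c, leaf_count (pred1 c)
    (relabel (ar' := fun j => l' (tagnat.sig1 j) (tagnat.sig2 j))
       (f := fun c => tagnat.Rank i c) (e i) (u i)) = 1.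
  move=> c.
  by rewrite leaf_count_relabel; have /bijectively_labelledP[_] := uP i.
apply/bijectively_labelledP; split => j; last by rewrite leaf_count_subst.
rewrite node_count_subst //.
under eq_bigr do rewrite t1 mul1n node_count_relabel.
have RankE i c : (tagnat.Rank i c == j) =
    (Tagged (fun i => 'I_(k i)) c == tagnat.sig j).
  by rewrite -(inj_eq (@tagnat.sig_inj _ k)) tagnat.rankK.
rewrite [LHS](bigD1 (tagnat.sig1 j)) //= [X in _ + X]big1 ?addn0 => [|i ij].
  have /bijectively_labelledP[+ _] := uP (tagnat.sig1 j).
  move=> /(_ (tagnat.sig2 j)) <-; apply: eq_node_count => c /=.
  by rewrite RankE tagnat.sigE12 eq_Tagged.
rewrite node_count_sum big1 // => c _ /=.
rewrite RankE tagnat.sigE12; case: eqP => // /(congr1 tag) /= ij'.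
by rewrite ij' eqxx in ij.
Qed.

Lemma Rank_sort m (k : 'I_m -> nat) (l' : forall i, 'I_(k i) -> nat) i c :
  l' (tagnat.sig1 (tagnat.Rank i c)) (tagnat.sig2 (tagnat.Rank i c)) = l' i c.
Proof. by rewrite /tagnat.sig1 /tagnat.sig2 tagnat.rankK. Qed.

Definition corolla n (s : 'S_n.+1) : Mset (fun _ : 'I_1 => n) n :=
  MTree (Mset_one_subproof s).

Definition Mset_soperad : set_soperad := {|
  so := Mset;
  so_act m l n s t := MTree (Mset_act_subproof s (svalP t));
  so_one n := corolla 1%g;
  so_comp m l n k l' t u :=
    MTree (Mset_comp_subproof (Rank_sort l') (svalP t) (fun i => svalP (u i))) |}.

(** The labels, among the inputs of [x o_i y], of the input [j] of [y] and of
    the input [c != i] of [x], where [y] has [m.+1] inputs. *)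
Definition inner n m (i : 'I_n.+1) (j : 'I_m.+1) : 'I_(n + m).+1 :=
  inord (i + j).
Definition outer n m (i c : 'I_n.+1) : 'I_(n + m).+1 :=
  inord (if c < i then c : nat else c + m).

Definition sorts2 (n m : nat) (b : 'I_2) : nat := if val b is 0 then n else m.

Definition graft_tree n m (i : 'I_n.+1) : tree (sorts2 n m) 'I_(n + m).+1 :=
  Node (ar := sorts2 n m) ord0 (fun c : 'I_n.+1 =>
    if c == i then Node (ar := sorts2 n m) ord_max (fun j : 'I_m.+1 => Leaf (inner i j))
    else Leaf (outer m i c)).

Lemma graft_subproof n m (i : 'I_n.+1) : bijectively_labelled (graft_tree m i).
Proof.
apply/bijectively_labelledP; split => [b|l] /=.
  rewrite (bigD1 i) //= eqxx /= big1 ?addn0 => [|c _//].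
  rewrite big1 ?addn0 => [|c ci]; last by rewrite (negPf ci).
  by case: b => -[|[|[]]].
have ltl := ltn_ord l.
rewrite (bigD1 i) //= eqxx /=.
rewrite (eq_bigr (fun c => (outer m i c == l) : nat)); last first.
  by move=> c ci; rewrite (negPf ci).
have inE j : (inner i j == l) = (i + j == l)%N.
  by rewrite -val_eqE /= inordK //; have := ltn_ord i; have := ltn_ord j; lia.
have outE c : (outer m i c == l) = ((if c < i then c : nat else c + m) == l)%N.
  rewrite -val_eqE /= inordK //; have := ltn_ord c.
  by case: (ltnP c i); lia.
under eq_bigr do rewrite inE; under [X in _ + X]eq_bigr do rewrite outE.
have [il|li] := leqP i l; last first.
  have ltln : l < n.+1 by exact: ltn_trans li (ltn_ord i).
  rewrite big1 ?add0n => [|j _]; last by case: eqP => //; lia.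
  rewrite (bigD1 (Ordinal ltln)) /=; last by rewrite -val_eqE /= ltn_eqF.
  rewrite li eqxx big1 ?addn0// => c /andP[ci]; rewrite -val_eqE /= => cl.
  by case: (ltnP c i) => ?; case: eqP => //; lia.
have [lim|iml] := leqP l (i + m).
  have ltlm : l - i < m.+1 by lia.
  rewrite (bigD1 (Ordinal ltlm)) //= subnKC // eqxx.
  rewrite big1 ?addn0 => [|j]; last first.
    by rewrite -val_eqE /= => jl; case: eqP => //; lia.
  rewrite big1 // => c; rewrite -val_eqE /= => ci.
  by case: (ltnP c i) => ?; case: eqP => //; lia.
have ltlm : l - m < n.+1 by lia.
rewrite big1 ?add0n => [|j _]; last first.
  have := ltn_ord j; move: (nat_of_ord j) => j'; rewrite /sorts2 /= => jm.
  by case: eqP => //; lia.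
rewrite (bigD1 (Ordinal ltlm)) /=; last by rewrite -val_eqE /=; lia.
rewrite ifF; last by lia.
rewrite subnK; last by lia.
rewrite eqxx big1 ?addn0// => c /andP[ci]; rewrite -val_eqE /= => cl.
by case: (ltnP c i) => ?; case: eqP => //; lia.
Qed.

(** The two-node tree whose root [0] has the node [1] as [i]-th successor. *)
Definition graft n m (i : 'I_n.+1) : Mset (sorts2 n m) (n + m) :=
  MTree (graft_subproof m i).

End Trees.

(** The space of operations with [n.+1] inputs is [op n]. The composite
    [x o_i y] of operations with [n.+1] and [m.+1] inputs has [(n + m).+1]
    inputs. [oact x s] is [x] with its input [c] relabelled [s c]; this is a
    right action for the composition order of [{perm _}]. No unit is part of
    the structure. *)
Record operad_data := OperadData {
  op :> nat -> topologicalType;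
  oact : forall n, op n -> 'S_n.+1 -> op n;
  ocomp : forall n m, op n -> 'I_n.+1 -> op m -> op (n + m) }.

Definition any_arity (O : operad_data) n (x : O n) : {n : nat & O n} :=
  existT (fun n => O n : Type) n x.

Record is_operad (O : operad_data) : Prop := IsOperad {
  op_cg : forall n, compactly_generated (O n);
  oact_continuous : forall n (s : 'S_n.+1),
    continuous (fun x : O n => oact x s);
  ocomp_continuous : forall n m (i : 'I_n.+1),
    continuous (fun xy : kpair (O n) (O m) => ocomp xy.1 i xy.2);
  oact1 : forall n (x : O n), oact x 1%g = x;
  oactM : forall n (x : O n) (s t : 'S_n.+1),
    oact x (s * t)%g = oact (oact x s) t;
  ocomp_seq : forall n m k (x : O n) (y : O m) (z : O k)
      (i : 'I_n.+1) (j : 'I_m.+1),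
    any_arity (ocomp (ocomp x i y) (inner i j) z) =
    any_arity (ocomp x i (ocomp y j z));
  ocomp_par : forall n m k (x : O n) (y : O m) (z : O k) (i j : 'I_n.+1),
    i != j ->
    any_arity (ocomp (ocomp x i y) (outer m i j) z) =
    any_arity (ocomp (ocomp x j z) (outer k j i) y);
  ocomp_equivariant : forall n m (x : O n) (y : O m) (i : 'I_n.+1)
      (s : 'S_n.+1) (t : 'S_m.+1) (r : 'S_(n + m).+1),
    (forall j, r (inner i j) = inner (s i) (t j)) ->
    (forall c, c != i -> r (outer m i c) = outer m (s i) (s c)) ->
    ocomp (oact x s) (s i) (oact y t) = oact (ocomp x i y) r }.

Record is_operad_morphism (O O' : operad_data) (f : forall n, O n -> O' n) :
    Prop := IsOperadMorphism {
  omor_continuous : forall n, continuous (f n);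
  omor_act : forall n (x : O n) (s : 'S_n.+1), f n (oact x s) = oact (f n x) s;
  omor_comp : forall n m (x : O n) (i : 'I_n.+1) (y : O m),
    f (n + m)%N (ocomp x i y) = ocomp (f n x) i (f m y) }.

Definition contractible (R : realType) (T : topologicalType) : Prop :=
  exists (x0 : T) (H : T * R -> T),
    [/\ {within [set: T] `*` `[0%R, 1%R], continuous H},
        forall x, H (x, 0%R) = x & forall x, H (x, 1%R) = x0].

Definition is_Einfty_operad (R : realType) (C : operad_data) : Prop :=
  [/\ is_operad C,
      forall n, contractible R (C n) &
      forall n (x : C n) (s : 'S_n.+1), oact x s = x -> s = 1%g].

(** The operad underlying an algebra over the sorted operad of trees, through
    the trees with one node and those with two nodes. *)
Section OperadOfTheta.
Variable Z : nat -> topologicalType.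
Variable theta : forall (m : posn) (l : 'I_(sval m) -> nat) n,
  Mset l n -> (forall i, Z (l i)) -> Z n.

Definition pair2 n m (x : Z n) (y : Z m) (b : 'I_2) : Z (sorts2 n m b) :=
  match val b as v return Z (if v is 0 then n else m) with
  | 0 => x
  | _.+1 => y
  end.

Definition posn2 : posn := exist _ 2%N isT.

Definition operad_of_trees : operad_data := {|
  op := Z;
  oact n x s := theta (m := posn1) (corolla s) (fun _ => x);
  ocomp n m x i y := theta (m := posn2) (graft m i) (pair2 x y) |}.
End OperadOfTheta.

Section Xi.
Variable R : realType.

Let D : top_soperad := Esoperad R Dset_soperad.
Let EM : top_soperad := Esoperad R Mset_soperad.
Let DEM : top_soperad := prod_soperad D EM.

(** [X(n) = B Sigma_{n-1}] reads [X n = BSym R n], as sorts are shifted by one. *)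
Let X : nat -> topologicalType := BSym R.

Definition X_act n : monad DEM X n -> X n :=
  malg (fun (m : posn) l n (p : so DEM l n) => Dtheta p.1) (n := n).

Definition monad_proj (Z : nat -> topologicalType) n (x : monad DEM Z n) :
  monad EM Z n :=
  let: existT l (p, z) := rpr (tagged x) in @mcls EM Z n (tag x) l p.2 z.

Definition EM_act (Z : nat -> topologicalType) n
  (x : monad EM (monad DEM Z) n) : monad EM Z n :=
  mmul (mmap (@monad_proj Z) x).

(** [NX q] is [N^q X]. For [j < q], [NXface q j] is [N^j] of the multiplication
    of [N], and [NXface q q] is [N^q] of the action on [X]; for [j <= q],
    [NXdegen q j] is [N^j] of the unit of [N]. *)
Fixpoint NX (q : nat) : nat -> topologicalType :=
  match q with 0 => X | q'.+1 => monad DEM (NX q') end.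

Fixpoint NXface (q j : nat) {struct q} :
    forall n, monad DEM (NX q) n -> NX q n :=
  match q return forall n, monad DEM (NX q) n -> NX q n with
  | 0 => X_act
  | q'.+1 =>
      match j with
      | 0 => @mmul DEM (NX q')
      | j'.+1 => @mmap DEM (monad DEM (NX q')) (NX q') (@NXface q' j')
      end
  end.

Fixpoint NXdegen (q j : nat) {struct q} :
    forall n, NX q n -> monad DEM (NX q) n :=
  match q return forall n, NX q n -> monad DEM (NX q) n with
  | 0 => @munit DEM X
  | q'.+1 =>
      match j with
      | 0 => @munit DEM (monad DEM (NX q'))
      | j'.+1 => @mmap DEM (NX q') (monad DEM (NX q')) (@NXdegen q' j')
      end
  end.

Definition bar (n : nat) : sspace := {|
  sp q := monad EM (NX q) n;
  face q i :=
    match val i return monad EM (monad DEM (NX q)) n -> monad EM (NX q) n with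
    | 0 => @EM_act (NX q) n
    | j.+1 => @mmap EM (monad DEM (NX q)) (NX q) (@NXface q j) n
    end;
  degen q i := @mmap EM (NX q) (monad DEM (NX q)) (@NXdegen q i) n |}.

Definition Xi_space (n : nat) : topologicalType := realize R (bar n).

(** The levelwise free [EM]-algebra structure, transported along the
    homeomorphism [prod_i |bar (l i)| = |prod_i bar (l i)|]. *)
Definition Xi_EMact (m : posn) (l : 'I_(sval m) -> nat) n (e : so EM l n)
    (x : forall i, Xi_space (l i)) : Xi_space n :=
  @realize_map R (sprod (fun i => bar (l i))) (bar n)
    (fun q (y : forall i, monad EM (NX q) (l i)) => mmul (mcls e y))
    (rprod_inv x).

Definition Xi : operad_data :=
  operad_of_trees (fun m l n (t : Mset l n) => Xi_EMact (Evertex R t)).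

End Xi.

(* Main.v *)
(** A point of [E Z] is a step function on the unit interval with values in [Z].
    Hence at each time [u] a point of [Xi n] is made of trees and permutations,
    which carry signs: the Koszul sign of a permutation of inputs of degrees
    [l i], and the sign by which a tree acts on the operadic suspension of the
    commutative operad. All these signs are compatible with composition, so
    that every [x] in [Xi n] has a step function [u |-> s_x(u) = +1, -1], well
    defined up to a global sign, continuous in [x] for the distance in measure,
    and such that [s_(x o_i y) = s_x s_y] and [s_(x sigma) = s_x] up to global
    signs. For [n = 1] (arity two) it is defined on the nose, and
    [s_(x tau) = - s_x] for the transposition [tau].

    Let [C -> Xi] be a morphism with [C] an E-infinity operad. As [C 3] is
    contractible, the signs [s] lift over [C 3] to a continuous family [S] of
    step functions, and [S_(z sigma) = chi(sigma) S_z] for a sign [chi(sigma)]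
    that does not depend on [z]; so [S_(z c c) = S_z] for the cycle [c] of order
    four. With [h(x) = (x o_0 y) o_2 y] also [S_(h(x)) = k s_x] for a constant
    sign [k]. Now [h(x tau) = h(x) c c], whence [s_(x tau) = s_x], a
    contradiction. *)
Require Import Defs.
From mathcomp Require Import all_boot all_order all_algebra perm generic_quotient.
From mathcomp Require Import all_classical all_reals topology normedtype.
From mathcomp Require Import sequences measure lebesgue_measure.
From mathcomp Require Import ring lra zify.

Set Implicit Arguments.
Unset Strict Implicit.
Unset Printing Implicit Defensive.

Import Order.TTheory GRing.Theory Num.Theory.
Import numFieldNormedType.Exports.

Local Open Scope classical_set_scope.
Local Open Scope ring_scope.

(** * Koszul signs *)

(** Signs are booleans added modulo two, [true] standing for -1. A point of a quotient is reached
    only through an arbitrary representative, so every sign function on a quotient is controlled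
    only up to [sign_equiv], whose global sign is forbidden in degree [n < 2]. The ambiguities come
    from Koszul signs and from left translations in ['S_n], and both need two odd inputs
    ([koszul_ge2]); this keeps arity two rigid, without which comparing [x] with [oact x tau] would
    say nothing.

    A simplex of the bar construction has one sign function for each of its vertices, since the
    vertex decides which copies of the monad act through trees and which through permutations. Hence
    the index [j] next to the time [u]: a cell is read at time [u] at the vertex whose interval
    contains [u], and faces and degeneracies become the reindexings [bump] and [unbump]. This is
    consistent because tree signs and permutation signs change by the same Koszul sign under the
    symmetric groups and are both additive under composition. *)

Lemma addbool (b : bool) : b + b = 0.
Proof. by case: b. Qed.

Lemma addboolK (b c : bool) : b + (b + c) = c.
Proof. by rewrite addrA addbool add0r. Qed.

Lemma addbool_eq0 (b c : bool) : b + c = 0 -> b = c.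
Proof. by case: b; case: c. Qed.

Lemma oddsum (I : Type) (r : seq I) (F : I -> nat) :
  odd (\sum_(i <- r) F i)%N = \sum_(i <- r) (odd (F i) : bool).
Proof. by elim/big_rec2: _ => // i y1 y2 _ <-; rewrite oddD. Qed.

(** Modulo two, the terms at [(i, j)] and [(j, i)] cancel; [enum_rank] supplies an order that
    separates them. *)
Lemma sum_sym0 (I : finType) (h : I -> I -> bool) :
  (forall i j, h i j = h j i) -> (forall i, h i i = 0) ->
  \sum_i \sum_j h i j = 0.
Proof.
move=> hC h0; pose lt (i j : I) := (enum_rank i < enum_rank j)%N.
have -> : \sum_i \sum_j h i j =
    \sum_i \sum_j lt i j * h i j + \sum_i \sum_j lt j i * h i j.
  rewrite -big_split; apply: eq_bigr => i _; rewrite -big_split.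
  apply: eq_bigr => j _ /=; rewrite -mulrDl.
  rewrite /lt; case: ltngtP => [||ij]; [by case: (h i j)..|].
  by have -> : i = j := enum_rank_inj (val_inj ij); rewrite h0 mulr0.
rewrite [X in _ + X]exchange_big /=.
under [X in _ + X]eq_bigr do under eq_bigr do rewrite hC.
exact: addbool.
Qed.

Lemma sum_delta_bool (I : finType) (i : I) (F : I -> bool) :
  \sum_j (i == j) * F j = F i.
Proof.
rewrite (bigD1 i) //= eqxx mul1r big1 ?addr0 // => j /negPf.
by rewrite eq_sym => ->; rewrite mul0r.
Qed.

Section Koszul.
Variable m : nat.

(** The Koszul sign of [s] permuting graded inputs whose degrees have the
    parities [w]. *)
Definition koszul (w : 'I_m -> bool) (s : 'S_m) : bool :=
  \sum_(i < m) \sum_(j < m) (i < j)%N * (s j < s i)%N * (w i * w j).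

(** A symmetric function summed over unordered pairs does not depend on which ordering of each pair
    represents it. *)
Lemma sum_pairs_perm (s : 'S_m) (f : 'I_m -> 'I_m -> bool) :
  (forall i j, f i j = f j i) ->
  \sum_(i < m) \sum_(j < m) (i < j)%N * f (s i) (s j) =
  \sum_(i < m) \sum_(j < m) (i < j)%N * f i j.
Proof.
move=> fC; rewrite (reindex_inj (@perm_inj _ s^-1)%g) /=.
under eq_bigr do rewrite (reindex_inj (@perm_inj _ s^-1)%g) /=.
apply: addbool_eq0.
rewrite -big_split /=; under eq_bigr do rewrite -big_split /=.
refine (@sum_sym0 _ (fun i j => _) _ _) => [i j|i]; last by rewrite !ltnn !mul0r.
rewrite !permKV (fC j i) -!mulrDl; have [->//|ij] := eqVneq i j.
have sij : (s^-1)%g i != (s^-1)%g j by rewrite (inj_eq perm_inj).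
congr (_ * _); move: ij sij; rewrite -!val_eqE /=.
by do 2![case: ltngtP => _ //=].
Qed.

(** Being an inversion is the difference of two order indicators, one before and one after [s]; in
    this form the cocycle identity [koszulM] telescopes. *)
Lemma koszulE (w : 'I_m -> bool) (s : 'S_m) :
  koszul w s = \sum_(i < m) \sum_(j < m)
    (i < j)%N * (((i < j)%N + (s i < s j)%N) * (w i * w j)).
Proof.
apply: eq_bigr => i _; apply: eq_bigr => j _.
case: (ltnP i j) => ij; rewrite ?mul0r // !mul1r; congr (_ * _).
have : s i != s j by rewrite (inj_eq perm_inj) -val_eqE neq_ltn ij.
by rewrite -val_eqE /=; case: ltngtP.
Qed.

Lemma koszulM (w : 'I_m -> bool) (s u : 'S_m) :
  koszul (w \o s) (s * u)%g = koszul (w \o s) s + koszul w u.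
Proof.
rewrite !koszulE.
have -> : \sum_(i < m) \sum_(j < m)
     (i < j)%N * (((i < j)%N + (u i < u j)%N) * (w i * w j)) =
   \sum_(i < m) \sum_(j < m) (i < j)%N *
     (((s i < s j)%N + (u (s i) < u (s j))%N) * (w (s i) * w (s j))).
  rewrite (@sum_pairs_perm s (fun i j => ((i < j)%N + (u i < u j)%N) * (w i * w j))) //.
  move=> i j; rewrite (mulrC (w j)); congr (_ * _).
  have [->//|ij] := eqVneq i j.
  have uij : u i != u j by rewrite (inj_eq perm_inj).
  by move: ij uij; rewrite -!val_eqE /=; do 2![case: ltngtP => _ //=].
rewrite -big_split; apply: eq_bigr => i _; rewrite -big_split.
apply: eq_bigr => j _; rewrite !permM /= -mulrDr -mulrDl; congr (_ * (_ * _)).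
by rewrite -addrA addboolK.
Qed.

Lemma koszul1 (w : 'I_m -> bool) : koszul w 1%g = 0.
Proof.
rewrite /koszul big1 // => i _; rewrite big1 // => j _.
by rewrite !perm1; case: ltngtP; rewrite ?(mul0r, mulr0).
Qed.

(** Only an inversion of two distinct odd inputs counts. This is the origin of the condition
    [2 <= n] in [sign_equiv]. *)
Lemma koszul_ge2 (l : 'I_m -> nat) (s : 'S_m) :
  koszul (odd \o l) s -> (2 <= \sum_i l i)%N.
Proof.
apply: contraTT; rewrite -ltnNge ltnS => l1; rewrite /koszul.
rewrite big1 // => i _; rewrite big1 // => j _ /=.
have [->|ij] := eqVneq i j; first by rewrite ltnn !mul0r.
have [li|] := boolP (odd (l i)); last by rewrite mul0r mulr0.
have [lj|] := boolP (odd (l j)); last by rewrite !mulr0.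
exfalso; move: l1; rewrite (bigD1 i) //= (bigD1 j) /=; last by rewrite eq_sym.
by move: (l i) (l j) li lj => [|?] [|?] //=; lia.
Qed.
End Koszul.

Lemma sum_Rank m (k : 'I_m -> nat) (V : nmodType) (F : 'I_(\sum_i k i) -> V) :
  \sum_j F j = \sum_i \sum_c F (tagnat.Rank i c).
Proof.
rewrite sig_big_dep /= (reindex _ (@tagnat.rank_bij_on _ k)) /=.
by apply: eq_bigr => -[i c] _; rewrite tagnat.rankE.
Qed.

Lemma ltn_Rank m (k : 'I_m -> nat) i c i' c' :
  (@tagnat.Rank m k i c < @tagnat.Rank m k i' c')%N =
  (i < i')%N || (i == i') && (c < c')%N.
Proof.
have lt_blocks a b (x : 'I_(k a)) (y : 'I_(k b)) : (a < b)%N ->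
    (tagnat.Rank a x < tagnat.Rank b y)%N.
  move=> ab; rewrite !tagnat.RankEsum.
  rewrite [X in (_ < X + _)%N](bigID (fun j : 'I_m => (j < a)%N)) /=.
  rewrite [X in (_ < X + _ + _)%N](eq_bigl (fun j : 'I_m => (j < a)%N)); last first.
    by move=> j; case: (ltnP j a) => ja; rewrite ?andbT ?andbF // (ltn_trans ja ab).
  rewrite [X in (_ < _ + X + _)%N](bigD1 a) /=; last by rewrite ab ltnn.
  by have := ltn_ord x; lia.
case: (ltngtP i i') => [ii'|i'i|/val_inj ii'].
- by rewrite lt_blocks.
- rewrite ltnNge ltnW ?lt_blocks //; apply/esym/negP => /andP[/eqP ii'].
  by subst i'; rewrite ltnn in i'i.
- by subst i'; rewrite eqxx andTb orFb !tagnat.RankEsum ltn_add2l.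
Qed.

(** Inputs of different blocks are inverted exactly when their blocks are, which gives products of
    block parities; inputs of one block are inverted by [t i]. *)
Lemma koszul_block_comp m (k : 'I_m -> nat) (w : 'I_(\sum_i k i) -> bool)
    (s : 'S_m) (t : forall i, 'S_(k i)) :
  koszul w (block_comp s t) =
  koszul (fun i => \sum_c w (tagnat.Rank i c)) s +
  \sum_i koszul (fun c => w (tagnat.Rank i c)) (t i).
Proof.
have bE i c : block_comp s t (tagnat.Rank i c) =
    tagnat.Rank (p_ := fun j => k (s^-1%g j)) (s i)
       (cast_ord (congr1 k (esym (permK s i))) (t i c)) :> nat.
  rewrite permE /block_comp_fun /=.
  rewrite /tagnat.sig1 /tagnat.sig2; by rewrite tagnat.rankK /=.
rewrite /koszul sum_Rank -big_split; apply: eq_bigr => i _ /=.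
under eq_bigr do rewrite sum_Rank.
rewrite exchange_big /=.
rewrite (eq_bigr (fun i' : 'I_m => (i < i')%N * (s i' < s i)%N *
    ((\sum_c w (tagnat.Rank i c)) * (\sum_c w (tagnat.Rank i' c))) +
   (i == i') * \sum_(c < k i) \sum_(c' < k i') (c < c')%N * (t i' c' < t i c)%N *
      (w (tagnat.Rank i c) * w (tagnat.Rank i' c')))); last first.
  move=> i' _; rewrite big_distrlr mulr_sumr mulr_sumr -big_split.
  apply: eq_bigr => c _; rewrite mulr_sumr mulr_sumr -big_split.
  apply: eq_bigr => c' _; rewrite ltn_Rank !bE ltn_Rank /= [(i == i') * _]mulrA -mulrDl.
  congr (_ * _); rewrite (inj_eq perm_inj) (eq_sym i' i).
  have [ii'|ii'] := eqVneq i i'; last by rewrite mul0r addr0 !orbF.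
  by subst i'; rewrite !ltnn !mul0r add0r mul1r.
by rewrite big_split sum_delta_bool.
Qed.

(** * Signs of trees *)

Section Inversions.
Variables (A : eqType) (key : A -> nat) (wt : A -> bool).

(** With [inversions] below: the Koszul sign of sorting a word of graded letters by [key], where
    [cross] is the share of the pairs with one letter in each word. *)
Definition cross (s t : seq A) : bool :=
  \sum_(a <- s) \sum_(b <- t) (key b < key a)%N * (wt a * wt b).

Fixpoint inversions (s : seq A) : bool :=
  if s is a :: s' then cross [:: a] s' + inversions s' else 0.

Definition weight (s : seq A) : bool := \sum_(a <- s) wt a.

Lemma cross_catl s s' t : cross (s ++ s') t = cross s t + cross s' t.
Proof. by rewrite /cross big_cat. Qed.

Lemma cross1l a t :
  cross [:: a] t = \sum_(b <- t) (key b < key a)%N * (wt a * wt b).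
Proof. by rewrite /cross big_seq1. Qed.

Lemma inversions_cat s t :
  inversions (s ++ t) = inversions s + cross s t + inversions t.
Proof.
elim: s => [|a s IH] /=; first by rewrite /cross big_nil !add0r.
rewrite IH -[a :: s]cat1s cross_catl [cross [:: a] (s ++ t)]/cross.
rewrite big_seq1 big_cat /= -[cross _ s]/(cross _ s) /cross !big_seq1.
ring.
Qed.

Lemma cross_flatten (I J : Type) (r : seq I) (r' : seq J) F G :
  cross (flatten [seq F i | i <- r]) (flatten [seq G j | j <- r']) =
  \sum_(i <- r) \sum_(j <- r') cross (F i) (G j).
Proof.
rewrite /cross big_flatten big_map; apply: eq_bigr => i _.
rewrite [RHS]exchange_big /=; apply: eq_bigr => a _.
by rewrite big_flatten big_map.
Qed.

(** With distinct keys, each pair of letters is inverted in exactly one of the two orders of [s] and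
    [t]. *)
Lemma cross_sym s t :
  (forall a b, a \in s -> b \in t -> key a != key b) ->
  cross s t + cross t s = weight s * weight t.
Proof.
move=> st; rewrite [cross t s]/cross exchange_big /= -big_split big_distrlr /=.
rewrite [LHS]big_seq [RHS]big_seq; apply: eq_bigr => a sa.
rewrite -big_split [LHS]big_seq [RHS]big_seq; apply: eq_bigr => b tb /=.
rewrite [wt b * _]mulrC -mulrDl; have := st _ _ sa tb.
by case: ltngtP => // _ _; rewrite ?addr0 ?add0r mul1r.
Qed.

Lemma perm_cross s s' t t' : perm_eq s s' -> perm_eq t t' ->
  cross s t = cross s' t'.
Proof.
move=> ss tt; rewrite /cross (perm_big _ ss); apply: eq_bigr => a _.
exact: perm_big.
Qed.
End Inversions.

Lemma eq_inversions (A : eqType) (k k' : A -> nat) (w w' : A -> bool) s :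
  (forall a b, (k b < k a)%N = (k' b < k' a)%N) -> w =1 w' ->
  inversions k w s = inversions k' w' s.
Proof.
move=> kk ww; elim: s => //= a s ->; congr (_ + _).
by apply: eq_bigr => b _; apply: eq_bigr => c _; rewrite kk !ww.
Qed.

Lemma inversions_map (A B : eqType) (k : B -> nat) (w : B -> bool) (f : A -> B) s :
  inversions k w (map f s) = inversions (k \o f) (w \o f) s.
Proof.
elim: s => //= a s ->; congr (_ + _).
by rewrite /cross !big_seq1 big_map.
Qed.

(** Replacing the letters of a word by blocks of the same parities changes the
    sign as if the blocks were first put into the order of the letters. *)
Lemma inversions_flatten (A B : eqType) (kA : A -> nat) (wA : A -> bool)
    (kB : B -> nat) (wB : B -> bool) (F : A -> seq B) s :
  uniq (map kA s) -> {in s, forall a, weight wB (F a) = wA a} ->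
  {in s &, forall a a', a != a' ->
    forall b b', b \in F a -> b' \in F a' -> kB b != kB b'} ->
  inversions kB wB (flatten (map F s)) =
  inversions kA wA s + \sum_(a <- s) inversions kB wB (F a) +
  \sum_(a <- s) \sum_(a' <- s) (kA a < kA a')%N * cross kB wB (F a) (F a').
Proof.
elim: s => [|a s IH] /= us Fw Fk; first by rewrite !big_nil.
have /andP[as_ us'] := us.
rewrite inversions_cat IH //; last first.
- by move=> x y xs ys; apply: Fk; rewrite inE ?xs ?ys orbT.
- by move=> x xs; apply: Fw; rewrite inE xs orbT.
rewrite !big_cons ltnn mul0r add0r.
rewrite [X in _ = _ + (_ + X)](eq_bigr (fun b =>
  (kA b < kA a)%N * cross kB wB (F b) (F a)
  + \sum_(a' <- s) (kA b < kA a')%N * cross kB wB (F b) (F a'))); last first.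
  by move=> b _; rewrite big_cons.
rewrite big_split /=.
suff -> : cross kB wB (F a) (flatten [seq F i | i <- s]) =
    cross kA wA [:: a] s +
    (\sum_(b <- s) (kA a < kA b)%N * cross kB wB (F a) (F b) +
     \sum_(b <- s) (kA b < kA a)%N * cross kB wB (F b) (F a)) by ring.
rewrite -big_split /= cross1l -big_split /=.
have -> : F a = flatten [seq F i | i <- [:: a]] by rewrite /= cats0.
rewrite cross_flatten big_seq1 [flatten _]/= cats0.
rewrite [LHS]big_seq [RHS]big_seq; apply: eq_bigr => b bs.
have ab : kA a != kA b by apply: contraNneq as_ => ->; exact: map_f.
have ab' : a != b by apply: contraNneq ab => ->.
have <- : weight wB (F a) = wA a by apply: Fw; rewrite inE eqxx.
have <- : weight wB (F b) = wA b by apply: Fw; rewrite inE bs orbT.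
rewrite -(@cross_sym _ kB); last first.
  by move=> x y xa yb; apply: Fk xa yb => //; rewrite inE ?eqxx ?bs ?orbT.
case: ltngtP ab => // _ _; rewrite ?mul1r ?mul0r ?addr0 ?add0r //.
by rewrite [cross _ _ (F b) _]lock -addrA addbool addr0.
Qed.

(** * Planar trees as words of graded letters *)

Section Preorder.
Variables (I : Type) (ar : I -> nat).

Fixpoint preorder L (t : tree ar L) : seq (I + L) :=
  match t with
  | Leaf x => [:: inr x]
  | Node i ts => inl i :: flatten [seq preorder (ts c) | c <- enum 'I_(ar i).+1]
  end.

Lemma preorder_bind L L' (f : L -> tree ar L') t :
  preorder (tree_bind f t) =
  flatten [seq match a with inl i => [:: inl i] | inr x => preorder (f x) end
    | a <- preorder t].
Proof.
elim: t => [x|i ts IH] /=; first by rewrite cats0.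
congr (_ :: _); elim: (enum _) => //= c s ->.
by rewrite map_cat flatten_cat IH.
Qed.

Lemma count_preorder_node L (p : pred I) (t : tree ar L) :
  count (fun a => if a is inl i then p i else false) (preorder t) = node_count p t.
Proof.
elim: t => //= i ts IH; rewrite count_flatten -map_comp sumnE big_map big_enum /=.
by congr (_ + _)%N; apply: eq_bigr => c _ /=.
Qed.

Lemma count_preorder_leaf L (p : pred L) (t : tree ar L) :
  count (fun a => if a is inr x then p x else false) (preorder t) = leaf_count p t.
Proof.
elim: t => [x|i ts IH] /=; first by rewrite addn0.
rewrite count_flatten -map_comp sumnE big_map big_enum /=.
by apply: eq_bigr => c _ /=.
Qed.
End Preorder.

Lemma map_enum_cast a b (e : a = b) T (F : 'I_b -> T) :
  [seq F (cast_ord e c) | c <- enum 'I_a] = [seq F c | c <- enum 'I_b].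
Proof. by subst b; apply: eq_map => c; rewrite cast_ord_id. Qed.

Definition relabel_letter I J L (f : I -> J) (a : I + L) : J + L :=
  match a with inl i => inl (f i) | inr x => inr x end.

Lemma preorder_relabel I J (ar : I -> nat) (ar' : J -> nat) L (f : I -> J)
    (e : forall i, ar' (f i) = ar i) (t : tree ar L) :
  preorder (relabel e t) = map (relabel_letter f) (preorder t).
Proof.
elim: t => //= i ts IH; congr (_ :: _); rewrite map_flatten -map_comp.
rewrite -(map_enum_cast (congr1 S (e i))); congr flatten.
by apply: eq_map => c /=.
Qed.

Lemma sum_true n : \sum_(i < n) true = odd n.
Proof.
elim: n => [|n IH]; first by rewrite big_ord0.
by rewrite big_ord_recr /= IH; case: (odd n).
Qed.

Section LetterSigns.
Variables m n : nat.

Definition letter_key (a : 'I_m + 'I_n) : nat :=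
  match a with inl i => i | inr x => (m + x)%N end.

(** A node with [(l i).+1] successors has degree [l i], a leaf has degree one. These degrees make
    every tree odd ([weight_preorder]), so a tree can take the place of a leaf without disturbing
    the signs around it. *)
Definition letter_wt (l : 'I_m -> nat) (a : 'I_m + 'I_n) : bool :=
  if a is inl i then odd (l i) else true.

Lemma letter_key_inj : injective letter_key.
Proof.
move=> [i|x] [j|y] /= e.
- by congr inl; apply: val_inj.
- by have := ltn_ord i; rewrite e ltnNge leq_addr.
- by have := ltn_ord j; rewrite -e ltnNge leq_addr.
- by congr inr; apply: val_inj; exact: addnI e.
Qed.

Lemma letter_key_leaf i x : (letter_key (inl i) < letter_key (inr x))%N.
Proof. by rewrite /= ltn_addr. Qed.

Lemma letter_key_leafN i x : (letter_key (inr x) < letter_key (inl i))%N = false.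
Proof. by apply/negbTE; rewrite -leqNgt ltnW ?letter_key_leaf. Qed.

Definition letters (s : seq 'I_m) : seq ('I_m + 'I_n) :=
  [seq inl i | i <- s] ++ [seq inr x | x <- enum 'I_n].

Lemma weight_preorder (l : 'I_m -> nat) (t : tree l 'I_n) :
  weight (letter_wt l) (preorder t) = true.
Proof.
elim: t => [x|i ts IH] /=; first by rewrite /weight big_seq1.
rewrite /weight big_cons big_flatten big_map big_enum /=.
under eq_bigr do rewrite -/(weight _ _) IH.
by rewrite sum_true /=; case: (odd _).
Qed.

(** The predicate [p] admits trees that carry only some of the node labels, such as a tree about to
    be inserted, whose labels form one block of those of the composite. *)
Lemma preorder_letters (l : 'I_m -> nat) (t : tree l 'I_n) (p : pred 'I_m) :
  (forall i, node_count (pred1 i) t = p i) ->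
  (forall x, leaf_count (pred1 x) t = 1%N) ->
  perm_eq (preorder t) (letters [seq i <- enum 'I_m | p i]).
Proof.
move=> tp tl; apply/allP => -[i|x] _ /=.
  rewrite (eq_count (a2 := fun a => if a is inl j then pred1 i j else false));
    last by case.
  rewrite count_preorder_node tp count_cat 2!count_map.
  rewrite (@eq_count _ (preim inr _) pred0) // count_pred0 addn0.
  rewrite (@eq_count _ _ (pred1 i)) // count_filter.
  rewrite (eq_count (a2 := predI (pred1 i) p)) //.
  have := count_uniq_mem i (filter_uniq p (enum_uniq 'I_m)).
  by rewrite count_filter mem_filter mem_enum andbT => ->.
rewrite (eq_count (a2 := fun a => if a is inr y then pred1 x y else false));
  last by case.
rewrite count_preorder_leaf tl count_cat 2!count_map.
rewrite (@eq_count _ (preim inl _) pred0) // count_pred0 add0n.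
by rewrite (@eq_count _ _ (pred1 x)) // count_uniq_mem ?enum_uniq ?mem_enum.
Qed.

Lemma uniq_letters s : uniq s -> uniq (letters s).
Proof.
move=> us; rewrite cat_uniq (map_inj_uniq (f := inl)) ?(map_inj_uniq (f := inr)).
- rewrite us enum_uniq andbT; apply/hasPn => a /mapP[x _ ->].
  by apply/mapP => -[].
- by move=> ? ? [].
- by move=> ? ? [].
Qed.
End LetterSigns.

Lemma cross_const (A : eqType) (k : A -> nat) (w : A -> bool) (c : bool) s t :
  {in s & t, forall a b, (k b < k a)%N = c} ->
  cross k w s t = c * (weight w s * weight w t).
Proof.
move=> st; rewrite /weight big_distrlr /= mulr_sumr [LHS]big_seq [RHS]big_seq.
apply: eq_bigr => a sa; rewrite mulr_sumr [LHS]big_seq [RHS]big_seq.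
by apply: eq_bigr => b tb; rewrite st.
Qed.

Lemma count_sum (A : Type) (p : pred A) (s : seq A) :
  count p s = (\sum_(a <- s) p a)%N.
Proof. by rewrite -sum1_count big_mkcond; apply: eq_bigr => a _; case: (p a). Qed.

Section PreorderSubst.
Variables (m M n : nat) (ar : 'I_m -> nat) (ar' : 'I_M -> nat) (p : 'I_M -> 'I_m).
Variable u : forall i, tree ar' 'I_(ar i).+1.
Hypothesis p_mono : forall j j', (p j < p j')%N -> (j < j')%N.
Hypothesis u_node : forall i j, node_count (pred1 j) (u i) = (p j == i).
Hypothesis u_leaf : forall i c, leaf_count (pred1 c) (u i) = 1%N.

Let block i := [seq j <- enum 'I_M | p j == i].

(** Here [p] sends a node of the composite to the outer node that it helps to replace. The expansion
    forgets the shape of [u i] and keeps its block of labels, which suffices for [cross] by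
    [perm_cross]. *)
Definition expand (a : 'I_m + 'I_n) : seq ('I_M + 'I_n) :=
  match a with
  | inl i => [seq inl j | j <- block i]
  | inr x => [:: inr x]
  end.

Lemma perm_preorder_u i : perm_eq (preorder (u i)) (letters (ar i).+1 (block i)).
Proof. by apply: preorder_letters => *; rewrite ?u_node ?u_leaf. Qed.

Lemma perm_preorder_subst (t : tree ar 'I_n) :
  perm_eq (preorder (tree_subst u t)) (flatten [seq expand a | a <- preorder t]).
Proof.
apply/allP => -[j|x] _ /=; rewrite count_flatten -map_comp sumnE big_map.
  rewrite (eq_count (a2 := fun a => if a is inl i then pred1 j i else false));
    last by case.
  rewrite count_preorder_node node_count_subst //.
  under eq_bigr do rewrite u_node.
  rewrite (bigD1 (p j)) //= eqxx muln1 big1 ?addn0 => [|i]; last first.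
    by rewrite eq_sym => /negPf ->; rewrite muln0.
  rewrite -count_preorder_node count_sum; apply/eqP; apply: eq_bigr => -[i|x] _ //=.
  rewrite count_map (@eq_count _ _ (pred1 j)) // count_filter.
  rewrite (eq_count (a2 := predI (pred1 j) (fun j => p j == i))) //.
  have := count_uniq_mem j (filter_uniq (fun j => p j == i) (enum_uniq 'I_M)).
  by rewrite count_filter mem_filter mem_enum andbT eq_sym => ->.
rewrite (eq_count (a2 := fun a => if a is inr y then pred1 x y else false));
  last by case.
rewrite count_preorder_leaf leaf_count_subst //.
rewrite -count_preorder_leaf count_sum; apply/eqP; apply: eq_bigr => -[i|y] _ //=.
  by rewrite count_map (@eq_count _ _ pred0) // count_pred0.
by rewrite addn0.
Qed.

(** The tree [u i] is odd and has [(ar i).+1] odd leaves, so its nodes together have the parity of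
    [ar i]. *)
Lemma weight_expand a : weight (letter_wt ar') (expand a) = letter_wt ar a.
Proof.
case: a => [i|x] /=; last by rewrite /weight big_seq1.
have := weight_preorder (u i); rewrite /weight (perm_big _ (perm_preorder_u i)) /=.
rewrite big_cat /= 2!big_map big_enum /=.
rewrite sum_true /=.
by rewrite [X in _ -> X = _]big_map /=; case: (odd _); case: (\sum_(_ <- _) _).
Qed.

(** Since [p] is monotone, letters of two different blocks compare as the blocks do, and the
    parities agree by [weight_expand]. The hypothesis prevents a block from meeting itself. *)
Lemma cross_expand (x y : seq ('I_m + 'I_n)) :
  (forall i, inl i \in x -> inl i \notin y) ->
  cross (@letter_key M n) (letter_wt ar')
    (flatten [seq expand a | a <- x]) (flatten [seq expand a | a <- y]) =
  cross (@letter_key m n) (letter_wt ar) x y.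
Proof.
move=> xy; rewrite cross_flatten [RHS]/cross [LHS]big_seq [RHS]big_seq.
apply: eq_bigr => a xa; rewrite [LHS]big_seq [RHS]big_seq; apply: eq_bigr => b yb.
rewrite (@cross_const _ _ _ (letter_key b < letter_key a)%N) ?weight_expand //.
case: a b xa yb => [i|a] [i'|b] xa yb a' b' /=; rewrite ?inE.
- move=> /mapP[j + ->] /mapP[j' + ->]; rewrite !mem_filter => /andP[/eqP ji _].
  move=> /andP[/eqP ji' _]; subst i i'; rewrite /=.
  have [pj|pj] := ltnP (p j') (p j); first exact: p_mono.
  apply/negbTE; rewrite -leqNgt ltnW //; apply: p_mono.
  rewrite ltn_neqAle pj andbT; apply: contraTneq yb => /val_inj <-.
  exact: xy.
- move=> /mapP[j _ ->] /eqP -> /=.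
  by rewrite !(@ltnNge (_ + _)) !(leq_trans (ltnW (ltn_ord _)) (leq_addr _ _)).
- by move=> /eqP -> /mapP[j _ ->]; rewrite /= !ltn_addr.
- by move=> /eqP -> /eqP ->; rewrite /= !ltn_add2l.
Qed.
End PreorderSubst.

Section SubstSigns.
Variables (m M n : nat) (ar : 'I_m -> nat) (ar' : 'I_M -> nat) (p : 'I_M -> 'I_m).
Variable u : forall i, tree ar' 'I_(ar i).+1.
Hypothesis p_mono : forall j j', (p j < p j')%N -> (j < j')%N.
Hypothesis u_node : forall i j, node_count (pred1 j) (u i) = (p j == i).
Hypothesis u_leaf : forall i c, leaf_count (pred1 c) (u i) = 1%N.

Lemma sum_letters q r (s : seq 'I_q) (F : 'I_q + 'I_r -> bool) :
  \sum_(a <- letters r s) F a = \sum_(i <- s) F (inl i) + \sum_(x < r) F (inr x).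
Proof. by rewrite /letters big_cat /= 2!big_map big_enum. Qed.

Lemma sorted_pairs_letters q r (s : seq 'I_q) (F : 'I_q + 'I_r -> 'I_q + 'I_r -> bool) :
  \sum_(a <- letters r s) \sum_(b <- letters r s)
    (letter_key a < letter_key b)%N * F a b =
  \sum_(i <- s) \sum_(j <- s) (i < j)%N * F (inl i) (inl j) +
  \sum_(i <- s) \sum_(x < r) F (inl i) (inr x) +
  \sum_(x < r) \sum_(y < r) (x < y)%N * F (inr x) (inr y).
Proof.
rewrite sum_letters; congr (_ + _).
  rewrite -big_split; apply: eq_bigr => i _; rewrite sum_letters /=; congr (_ + _).
  by apply: eq_bigr => x _; rewrite ltn_addr // mul1r.
apply: eq_bigr => x _; rewrite sum_letters big1 ?add0r => [|i _].
  by apply: eq_bigr => y _; rewrite /= ltn_add2l.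
by rewrite letter_key_leafN mul0r.
Qed.

Lemma inversions1 (A : eqType) k w (a : A) : inversions k w [:: a] = 0.
Proof. by rewrite /= /cross big_seq1 big_nil addr0. Qed.

Lemma inversions_sorted (A : eqType) k w (s : seq A) :
  sorted ltn (map k s) -> inversions k w s = 0.
Proof.
elim: s => //= a s IH pa.
have -> : inversions k w s = 0 by apply: IH; exact: path_sorted pa.
rewrite addr0 cross1l big_seq big1 // => b bs.
have /allP/(_ (k b)) := order_path_min ltn_trans pa.
by rewrite map_f // => /(_ isT); case: ltngtP => //; rewrite mul0r.
Qed.

Lemma inversions_letters q r w (s : seq 'I_q) : sorted ltn (map val s) ->
  inversions (@letter_key q r) w (letters r s) = 0.
Proof.
move=> ss; apply: inversions_sorted; rewrite /letters map_cat.
have -> : [seq @letter_key q r i | i <- [seq inl i | i <- s]] = map val s.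
  by rewrite -map_comp.
have -> : [seq @letter_key q r i | i <- [seq inr x | x <- enum 'I_r]] = iota q r.
  transitivity [seq addn q i | i <- map val (enum 'I_r)]; first by rewrite -!map_comp.
  by rewrite val_enum_ord -iotaDl addn0.
rewrite sorted_pairwise; last exact: ltn_trans.
rewrite pairwise_cat -!sorted_pairwise; try exact: ltn_trans.
rewrite ss iota_ltn_sorted !andbT; apply/allrelP => x y /mapP[j _ ->].
by rewrite mem_iota => /andP[qy _]; exact: leq_trans (ltn_ord j) qy.
Qed.

Lemma uniq_flatten_disjoint (A B : eqType) (f : A -> seq B) s c c' a :
  uniq (flatten [seq f c | c <- s]) -> c \in s -> c' \in s -> c != c' ->
  a \in f c -> a \notin f c'.
Proof.
elim: s => //= d s IH; rewrite cat_uniq => /and3P[_ /hasPn dsN us].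
have dis x y : x \in f d -> y \in s -> x \notin f y.
  move=> xd ys; apply: contraL xd => xy; apply: dsN.
  by apply/flatten_mapP; exists y.
rewrite !inE => /predU1P[->|cs] /predU1P[->|c's]; first by rewrite eqxx.
- by move=> _ ad; exact: dis.
- by move=> _ ac; apply: contraL ac => ad; exact: dis.
- exact: IH.
Qed.

Lemma uniq_flatten_in (A : eqType) (B : eqType) (f : A -> seq B) s c :
  uniq (flatten [seq f c | c <- s]) -> c \in s -> uniq (f c).
Proof.
elim: s => //= d s IH; rewrite cat_uniq => /and3P[ud _ us].
by rewrite inE => /predU1P[->//|]; exact: IH.
Qed.

(** The trees act by signs: this is the structure of an operad on the graded
    lines of degree [n] in arity [n.+1], the operadic suspension of the
    commutative operad. *)
Lemma inversions_subst (t : tree ar 'I_n) : uniq (preorder t) ->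
  inversions (@letter_key M n) (letter_wt ar') (preorder (tree_subst u t)) =
  inversions (@letter_key m n) (letter_wt ar) (preorder t) +
  \sum_i odd (node_count (pred1 i) t) *
     inversions (@letter_key M (ar i).+1) (letter_wt ar') (preorder (u i)).
Proof.
elim: t => [x|i ts IH] us.
  rewrite !inversions1 big1 ?addr0 // => j _; by rewrite mul0r.
(* The words of the subtrees before and after substitution. Putting them at the leaf letters of a
   corolla ([G]) or of [u i] ([F]) produces the two words to be compared. *)
pose V c := preorder (ts c); pose W c := preorder (tree_subst u (ts c)).
pose G (a : 'I_m + 'I_(ar i).+1) : seq ('I_m + 'I_n) :=
  match a with inl j => [:: inl j] | inr c => V c end.
pose F (a : 'I_M + 'I_(ar i).+1) : seq ('I_M + 'I_n) :=
  match a with inl j => [:: inl j] | inr c => W c end.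
have WV c b : b \in W c -> relabel_letter p b \in V c.
  rewrite (perm_mem (perm_preorder_subst u_node u_leaf (ts c))).
  case/flatten_mapP => -[k|x] ka; last by rewrite inE => /eqP ->.
  by case/mapP => j; rewrite mem_filter => /andP[/eqP pj _] -> /=; rewrite pj.
have iV c : inl i \notin V c.
  have /= /andP[+ _] := us; apply: contra => iV.
  by apply/flatten_mapP; exists c; rewrite ?mem_enum.
have uV : uniq (flatten [seq V c | c <- enum 'I_(ar i).+1]) by have /andP[] := us.
have VV c c' a : c != c' -> a \in V c -> a \notin V c'.
  by apply: uniq_flatten_disjoint uV _ _; rewrite mem_enum.
have usV c : uniq (V c) by apply: uniq_flatten_in uV _; rewrite mem_enum.
have GE : preorder (Node i ts) = flatten [seq G a | a <- letters (ar i).+1 [:: i]].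
  by rewrite /letters /= -map_comp.
have FE : preorder (tree_subst u (Node i ts)) = flatten [seq F a | a <- preorder (u i)].
  exact: preorder_bind.
have pu := perm_preorder_u u_node u_leaf i.
set bl := [seq j <- _ | _] in pu.
rewrite GE FE.
rewrite (@inversions_flatten _ _ (@letter_key _ _) (letter_wt ar')); first last.
- move=> a a' ; rewrite !(perm_mem pu) => aL a'L aa' b b' bF b'F.
  rewrite (inj_eq (@letter_key_inj _ _)).
  have pb d : d \in letters (ar i).+1 bl -> forall x, x \in F d ->
      if d is inr c then relabel_letter p x \in V c else relabel_letter p x = inl i.
    rewrite mem_cat => /orP[]/mapP[j + ->] x /=; last by move=> _; exact: WV.
    by rewrite mem_filter inE => /andP[/eqP pj _] /eqP -> /=; rewrite pj.
  have := pb _ aL _ bF; have := pb _ a'L _ b'F.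
  case: a a' aa' {aL a'L} bF b'F => [j|c] [j'|c'] aa' //=.
  + by rewrite !inE => /eqP -> /eqP -> _ _; apply: contra aa' => /eqP[->].
  + move=> _ _ + bi; apply: contraTneq => <-; rewrite bi; exact: iV.
  + move=> _ _ b'i +; apply: contraTneq => ->; rewrite b'i; exact: iV.
  + move=> _ _ + bV; apply: contraTneq => <-; exact: VV bV.
- by move=> [j|c] _ /=; rewrite ?weight_preorder // /weight big_seq1.
- rewrite (map_inj_uniq (@letter_key_inj _ _)) (perm_uniq pu) uniq_letters //.
  exact/filter_uniq/enum_uniq.
rewrite (@inversions_flatten _ _ (@letter_key _ _) (letter_wt ar)); first last.
- move=> a a' aL a'L aa' b b' bF b'F; rewrite (inj_eq (@letter_key_inj _ _)).
  move: aL a'L; rewrite !mem_cat !inE.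
  case: a a' aa' bF b'F => [j|c] [j'|c'] aa' /=.
  + move=> _ _ /orP[/eqP[ji]|/mapP[]//] /orP[/eqP[j'i]|/mapP[]//].
    by move: aa'; rewrite ji j'i eqxx.
  + rewrite inE => /eqP -> b'V /orP[/eqP[->]|/mapP[]//] _.
    by apply: contraTneq b'V => <-; exact: iV.
  + rewrite inE => bV /eqP -> _ /orP[/eqP[->]|/mapP[]//].
    by apply: contraTneq bV => ->; exact: iV.
  + move=> bV + _ _; apply: contraTneq => <-; exact: VV bV.
- by move=> [j|c] _ /=; rewrite ?weight_preorder // /weight big_seq1.
- by rewrite (map_inj_uniq (@letter_key_inj _ _)) uniq_letters.
rewrite inversions_letters // add0r.
(* The remaining sums see [preorder (u i)] only up to permutation, so it can be replaced by its
   nodes [bl] followed by its leaves in order, parallel to the letter [i] followed by its leaves. *)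
rewrite (perm_big _ pu) /=.
under [X in _ + X]eq_bigr do rewrite (perm_big _ pu).
rewrite [X in _ + X](perm_big _ pu) /=.
rewrite !sorted_pairs_letters !sum_letters !big_seq1.
have -> : \sum_(j <- bl) inversions (@letter_key M n) (letter_wt ar') (F (inl j)) = 0.
  by rewrite big1 // => j _; exact: inversions1.
rewrite inversions1 ltnn mul0r !add0r.
have -> : \sum_(j <- bl) \sum_(j' <- bl) (j < j')%N *
    cross (@letter_key M n) (letter_wt ar') (F (inl j)) (F (inl j')) = 0.
  rewrite big1 // => j _; rewrite big1 // => j' _ /=.
  by rewrite /cross !big_seq1 /=; case: ltngtP => _; rewrite ?mul0r ?mulr0.
rewrite add0r.
(* The node [i] crosses the subtrees with the same sign as the block of nodes that replaces it. *)
have -> : \sum_(j <- bl) \sum_(x < (ar i).+1)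
      cross (@letter_key M n) (letter_wt ar') (F (inl j)) (F (inr x)) =
    \sum_(x < (ar i).+1)
      cross (@letter_key m n) (letter_wt ar) (G (inl i)) (G (inr x)).
  rewrite exchange_big /=; apply: eq_bigr => c _.
  rewrite -(cross_expand p_mono u_node u_leaf); last first.
    by move=> k; rewrite inE => /eqP[->]; exact: iV.
  transitivity (cross (@letter_key M n) (letter_wt ar') [seq inl j | j <- bl] (W c)).
    by rewrite [RHS]/cross big_map; apply: eq_bigr => j _; rewrite cross1l.
  apply: perm_cross; first by rewrite /= cats0.
  exact: perm_preorder_subst.
have -> : \sum_(x < (ar i).+1) \sum_(y < (ar i).+1) (x < y)%N *
    cross (@letter_key M n) (letter_wt ar') (F (inr x)) (F (inr y)) =
  \sum_(x < (ar i).+1) \sum_(y < (ar i).+1) (x < y)%N *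
    cross (@letter_key m n) (letter_wt ar) (G (inr x)) (G (inr y)).
  apply: eq_bigr => x _; apply: eq_bigr => y _.
  case: ltnP => xy; rewrite ?mul0r // !mul1r /=.
  rewrite -(cross_expand p_mono u_node u_leaf); last first.
    by move=> k; apply: VV; rewrite -val_eqE neq_ltn xy.
  by apply: perm_cross; exact: perm_preorder_subst.
have -> : \sum_(c < (ar i).+1) inversions (@letter_key M n) (letter_wt ar') (F (inr c)) =
    \sum_(c < (ar i).+1) inversions (@letter_key m n) (letter_wt ar) (G (inr c)) +
    \sum_(c < (ar i).+1) \sum_k odd (node_count (pred1 k) (ts c)) *
     inversions (@letter_key M (ar k).+1) (letter_wt ar') (preorder (u k)).
  by rewrite -big_split; apply: eq_bigr => c _; exact: IH (usV c).
under [X in _ = _ + X]eq_bigr do rewrite /= oddD oddsum oddb -[_ (+) _]/(_ + _) mulrDl.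
rewrite big_split /= sum_delta_bool.
under [X in _ = _ + (_ + X)]eq_bigr do rewrite mulr_suml.
rewrite [X in _ = _ + (_ + X)]exchange_big /=.
ring.
Qed.
End SubstSigns.

Lemma eq_koszul m (w w' : 'I_m -> bool) s : w =1 w' -> koszul w s = koszul w' s.
Proof.
by move=> ww; apply: eq_bigr => i _; apply: eq_bigr => j _; rewrite !ww.
Qed.

(** * Signs of trees and of permutations as operations *)

Definition tree_sign m (l : 'I_m -> nat) n (t : Mset l n) : bool :=
  inversions (@letter_key m n.+1) (letter_wt l) (preorder (sval t)).

Definition perm_sign m (l : 'I_m -> nat) n (s : Dset l n) : bool :=
  koszul (odd \o l) (sval s).

Section TreeSign.
Variables (m : nat) (l : 'I_m -> nat) (n : nat).
Implicit Type t : Mset l n.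

Lemma Mset_letters t : perm_eq (preorder (sval t)) (letters n.+1 (enum 'I_m)).
Proof.
have /bijectively_labelledP[t1 t2] := svalP t.
have := @preorder_letters m n.+1 l (sval t) xpredT.
by rewrite filter_predT; apply => // i; rewrite t1.
Qed.

Lemma uniq_preorder t : uniq (preorder (sval t)).
Proof. by rewrite (perm_uniq (Mset_letters t)) uniq_letters ?enum_uniq. Qed.

Lemma leaves_preorder (t : tree l 'I_n.+1) :
  (\sum_(a <- preorder t) (if a is inr _ then 1 else 0) =
   (\sum_(a <- preorder t) (if a is inl i then l i else 0)).+1)%N.
Proof.
elim: t => [x|i ts IH] /=; first by rewrite !big_seq1.
rewrite !big_cons !big_flatten 2!big_map !big_enum /= add0n.
under eq_bigr do rewrite IH -addn1.
by rewrite big_split /= sum1_card card_ord addnC addSn.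
Qed.

Lemma Mset_arity t : n = (\sum_i l i)%N.
Proof.
have := leaves_preorder (sval t).
rewrite !(perm_big _ (Mset_letters t)) /= /letters !big_cat /=.
rewrite 4!big_map !big_enum /= big1 // add0n.
by rewrite sum1_card card_ord big1_eq addn0 => -[].
Qed.

(** Relabelling keeps the word and the degrees and only changes the order of reference of the nodes.
    The resulting Koszul sign is the one of [perm_sign_act], so both signs can be used on the
    product of the two sorted operads. *)
Lemma tree_sign_act (s : 'S_m) t :
  tree_sign (so_act (s0 := Mset_soperad) s t) = koszul (odd \o l \o s) s + tree_sign t.
Proof.
rewrite /tree_sign /= preorder_relabel inversions_map.
set f := relabel_letter _; pose k1 := @letter_key m n.+1 \o f.
(* Cutting the word into one-letter blocks lets [inversions_flatten] compare two keys on the same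
   word. *)
have <- : flatten [seq [:: a] | a <- preorder (sval t)] = preorder (sval t).
  by elim: (preorder _) => //= a r ->.
rewrite (@inversions_flatten _ _ (@letter_key m n.+1) (letter_wt l)); first last.
- move=> a a' _ _ aa' b b'; rewrite !inE => /eqP-> /eqP->.
  rewrite /k1 /= (inj_eq (@letter_key_inj _ _)) /f.
  case: a a' aa' => [i|x] [j|y] //= aa'.
  by apply: contra aa' => /eqP[/perm_inj ->].
- by move=> [i|x] _ /=; rewrite /weight big_seq1 //= permKV.
- rewrite (map_inj_uniq (@letter_key_inj _ _)); exact: uniq_preorder.
rewrite [X in _ + X + _]big1 ?addr0 => [|a _]; last exact: inversions1.
have -> : flatten [seq [:: a] | a <- preorder (sval t)] = preorder (sval t).
  by elim: (preorder _) => //= a r ->.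
rewrite addrC; congr (_ + _).
rewrite (perm_big _ (Mset_letters t)) /=.
under eq_bigr do rewrite (perm_big _ (Mset_letters t)).
rewrite sorted_pairs_letters /=.
rewrite [X in _ + X + _]big1 ?addr0 => [|i _]; last first.
  rewrite big1 // => x _; rewrite /cross !big_seq1 /=.
  by rewrite ltnNge (leq_trans (ltnW (ltn_ord _)) (leq_addr _ _)) mul0r.
rewrite [X in _ + X]big1 ?addr0 => [|x _]; last first.
  rewrite big1 // => y _; rewrite /cross !big_seq1 /= ltn_add2l.
  by case: ltngtP => // _; rewrite !mul0r.
(* The sum that is left is the sign of [s^-1], which the cocycle identity equates with that of
   [s]. *)
have := koszulM (odd \o l) s s^-1%g; rewrite mulgV koszul1 => /esym/addbool_eq0 ->.
rewrite big_enum /=; apply: eq_bigr => i _; rewrite big_enum /=.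
apply: eq_bigr => j _; rewrite /cross !big_seq1 /= !permKV.
by rewrite mulrA.
Qed.
End TreeSign.

Lemma tree_sign_comp m (l : 'I_m -> nat) n (k : 'I_m -> nat)
    (l' : forall i, 'I_(k i) -> nat) (t : Mset l n)
    (u : forall i, Mset (l' i) (l i)) :
  tree_sign (so_comp (s0 := Mset_soperad) t u) =
  tree_sign t + \sum_i tree_sign (u i).
Proof.
have /bijectively_labelledP[t1 t2] := svalP t.
have uP i := elimT (bijectively_labelledP _) (svalP (u i)).
rewrite /tree_sign /=.
rewrite (@inversions_subst _ _ _ l (fun j => l' (tagnat.sig1 j) (tagnat.sig2 j))
  (fun j => tagnat.sig1 j)); last exact: uniq_preorder.
- congr (_ + _); apply: eq_bigr => i _; rewrite t1 mul1r.
  rewrite preorder_relabel inversions_map; apply: eq_inversions => [|[c|x]].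
    pose key := @letter_key (\sum_i k i) (l i).+1; move=> [c|x] [c'|x'].
    + rewrite -[LHS]/(tagnat.Rank i c' < tagnat.Rank i c)%N ltn_Rank ltnn eqxx.
      by [].
    + rewrite -[LHS]/(key (inr x') < key (inl (tagnat.Rank i c)))%N.
      by rewrite /key !letter_key_leafN.
    + rewrite -[LHS]/(key (inl (tagnat.Rank i c')) < key (inr x))%N.
      by rewrite /key !letter_key_leaf.
    + rewrite -[LHS]/(\sum_i k i + x' < \sum_i k i + x)%N -[RHS]/(k i + x' < k i + x)%N.
      by rewrite !ltn_add2l.
  + by rewrite /= Rank_sort.
  + by [].
- move=> j j' jj'; rewrite -[j]tagnat.sig2K -[j']tagnat.sig2K ltn_Rank.
  by rewrite jj'.
- move=> i j; rewrite node_count_relabel.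
  have RankE i' c : (tagnat.Rank i' c == j) =
      (Tagged (fun i => 'I_(k i)) c == tagnat.sig j).
    by rewrite -(inj_eq (@tagnat.sig_inj _ k)) tagnat.rankK.
  have [<-|ji] := eqVneq (tagnat.sig1 j) i.
    rewrite -[RHS]((uP (tagnat.sig1 j)).1 (tagnat.sig2 j)).
    by apply: eq_node_count => c /=; rewrite RankE tagnat.sigE12 eq_Tagged.
  rewrite node_count_sum big1 // => c _ /=.
  rewrite RankE tagnat.sigE12; case: eqP => // /(congr1 tag) /= ij.
  by rewrite ij eqxx in ji.
- by move=> i c; rewrite leaf_count_relabel; case: (uP i).
Qed.

Lemma tree_sign_corolla1 n : tree_sign (corolla (1%g : 'S_n.+1)) = 0.
Proof.
rewrite /tree_sign -(@inversions_letters 1 n.+1 (letter_wt (fun=> n)) [:: ord0]) //.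
congr inversions; rewrite /= /letters; congr (_ :: _).
by elim: (enum _) => //= c r ->; rewrite perm1.
Qed.

(** The node stays first and two leaves of degree one are exchanged. This is the sign that the final
    contradiction needs. *)
Lemma tree_sign_tau : tree_sign (corolla (tperm ord0 ord_max : 'S_2)) = true.
Proof.
rewrite /tree_sign (_ : preorder _ = [:: inl ord0; inr ord_max; inr ord0]).
  by rewrite /= /cross !big_cons !big_nil.
rewrite /= !enum_ordSl /= enum_ord0 /=.
have -> : lift ord0 ord0 = ord_max :> 'I_2 by apply: val_inj.
by rewrite tpermL tpermR.
Qed.

Lemma perm_sign_act m (l : 'I_m -> nat) n (s : 'S_m) (u : Dset l n) :
  perm_sign (so_act (s0 := Dset_soperad) s u) = koszul (odd \o l \o s) s + perm_sign u.
Proof. exact: koszulM. Qed.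

Lemma perm_sign_one n : perm_sign (so_one Dset_soperad n) = 0.
Proof. exact: koszul1. Qed.

Lemma perm_sign_comp m (l : 'I_m -> nat) n (k : 'I_m -> nat)
    (l' : forall i, 'I_(k i) -> nat) (u : Dset l n)
    (v : forall i, Dset (l' i) (l i)) :
  perm_sign (so_comp (s0 := Dset_soperad) u v) =
  perm_sign u + \sum_i perm_sign (v i).
Proof.
rewrite /perm_sign /= koszul_block_comp; congr (_ + _).
  apply: eq_koszul => i /=; rewrite (eqP (svalP (v i))) oddsum.
  by apply: eq_bigr => c _; rewrite Rank_sort.
apply: eq_bigr => i _; apply: eq_koszul => c /=; by rewrite Rank_sort.
Qed.

(** * Step functions up to sign *)

Section SmallSets.
Variable R : realType.
Implicit Types (A B : set R) (e : R).

(** In the library [lebesgue_measure] is defined on all sets, as the outer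
    measure; no measurability is needed here. *)
Definition small e A : Prop :=
  (lebesgue_measure (A : set (measurableTypeR R)) < e%:E)%E.

Let mu_ge0 A : (0 <= lebesgue_measure (A : set (measurableTypeR R)))%E.
Proof. exact: outer_measure_ge0. Qed.

Lemma small_sub e A B : A `<=` B -> small e B -> small e A.
Proof. by move=> AB; apply: le_lt_trans; exact: le_outer_measure. Qed.

Lemma smallW e e' A : e <= e' -> small e A -> small e' A.
Proof. by move=> ee'; move=> /lt_le_trans; apply; rewrite lee_fin. Qed.

Lemma smallU e e' A B : small e A -> small e' B -> small (e + e') (A `|` B).
Proof.
move=> sA sB; rewrite /small EFinD; apply: (le_lt_trans (outer_measureU2 _ _ _)).
exact: lteD.
Qed.

Lemma small0 e : 0 < e -> small e set0.
Proof. by move=> e0; rewrite /small measure0 lte_fin. Qed.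

(** The room left by the strict inequality makes conditions of closeness open
    ([sign_continuous_open]). *)
Lemma small_gap e A : small e A -> exists2 d, 0 < d & small (e - d) A.
Proof.
rewrite /small; have := mu_ge0 A; case: (lebesgue_measure _) => // m m0 me.
rewrite lte_fin in me; exists ((e - m) / 2); first by rewrite divr_gt0 ?subr_gt0.
by rewrite lte_fin; lra.
Qed.

Lemma small_itv e a b : 0 < e -> `|b - a| < e ->
  small e [set u | a <= u < b \/ b <= u < a].
Proof.
move=> e0 abe; wlog ab : a b abe / a <= b => [H|].
  case/orP: (le_total a b) => ab; first exact: H.
  apply: small_sub (H b a _ ab); last by rewrite distrC.
  by move=> u [?|?]; [right|left].
apply: (@small_sub _ _ `[a, b[%classic).
  by move=> u /= []; rewrite in_itv //=; move: ab; lra.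
rewrite /small lebesgue_measure_itv /= lte_fin.
case: (ltP a b) => _; last by rewrite lte_fin.
by rewrite -EFinD lte_fin; move: abe; rewrite ger0_norm ?subr_ge0.
Qed.

Lemma unit_interval_not_small : ~ small 1 [set u : R | 0 <= u < 1].
Proof.
have -> : [set u : R | 0 <= u < 1] = `[0, 1[%classic.
  by apply/seteqP; split => u /=; rewrite in_itv.
by rewrite /small lebesgue_measure_itv /= lte01 -EFinD subr0 ltxx.
Qed.
End SmallSets.

Section SignedSteps.
Variables (R : realType) (J : Type).
Implicit Types (F G H : R -> J -> bool) (b : bool) (n : nat).

(** The index type [J] is [nat] for the vertices of a simplex and [unit] for a point of a
    realization; values at a time are compared at all indices together. *)
Definition differ F G : set R := [set u | 0 <= u < 1 /\ F u <> G u].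
Definition step_close (e : R) F G : Prop := small e (differ F G).
Definition flip b F : R -> J -> bool := fun u j => b (+) F u j.

Lemma flipK b F : flip b (flip b F) = F.
Proof. by apply/funext => u; apply/funext => j; rewrite /flip addbA addbb. Qed.

Lemma flip0 F : flip false F = F.
Proof. by []. Qed.

Lemma flip_flip b c F : flip b (flip c F) = flip (b (+) c) F.
Proof. by apply/funext => u; apply/funext => j; rewrite /flip addbA. Qed.

Lemma step_close_refl e F : 0 < e -> step_close e F F.
Proof. by move=> /small0; apply: small_sub => u []. Qed.

Lemma step_close_sym e F G : step_close e F G -> step_close e G F.
Proof. by apply: small_sub => u [u01 /nesym]. Qed.

Lemma step_close_trans e e' F G H :
  step_close e F G -> step_close e' G H -> step_close (e + e') F H.
Proof.
move=> FG GH; apply: small_sub (smallU FG GH) => u [u01 FH].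
by have [FGu|] := pselect (F u = G u); [right|left]; split => //; rewrite -FGu.
Qed.

Lemma step_closeW e e' F G : e <= e' -> step_close e F G -> step_close e' F G.
Proof. exact: smallW. Qed.

Lemma step_close_flip e b F G : step_close e F G -> step_close e (flip b F) (flip b G).
Proof.
by apply: small_sub => u [u01 FG]; split => // FGu; apply: FG; rewrite /flip FGu.
Qed.

Lemma step_close_flipLR e b F G : step_close e (flip b F) G -> step_close e F (flip b G).
Proof. by move=> /(step_close_flip b); rewrite flipK. Qed.

(** Opposite functions differ at every time, and [[0, 1)] has measure one. *)
Lemma step_close_flip_inj (j : J) b c F : step_close 1 (flip b F) (flip c F) -> b = c.
Proof.
case: (eqVneq b c) => // bc; move=> /small_sub H.
case: (unit_interval_not_small (R := R)); apply: H => u u01; split => //.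
move=> /(congr1 (fun f => f j)); rewrite /flip.
by move: bc; case: b; case: c; case: (F u j).
Qed.

(** Step functions up to a global sign, which is allowed only in the degrees
    [n >= 2]. *)
Definition sign_equiv (P : J -> Prop) n F G : Prop :=
  exists2 b : bool, (b -> (2 <= n)%N) &
    forall u, 0 <= u < 1 -> forall j, P j -> F u j = b (+) G u j.

Lemma sign_equiv_refl P n F : sign_equiv P n F F.
Proof. by exists false. Qed.

Lemma sign_equiv_sym P n F G : sign_equiv P n F G -> sign_equiv P n G F.
Proof.
by move=> [b b2 FG]; exists b => // u u01 j Pj; rewrite FG // addbA addbb.
Qed.

Lemma sign_equiv_trans P n F G H :
  sign_equiv P n F G -> sign_equiv P n G H -> sign_equiv P n F H.
Proof.
move=> [b b2 FG] [c c2 GH]; exists (b (+) c); first by case: b c b2 c2 {FG GH} => [] [].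
by move=> u u01 j Pj; rewrite FG // GH // addbA.
Qed.

Lemma sign_equivW P n m F G : (n <= m)%N -> sign_equiv P n F G -> sign_equiv P m F G.
Proof.
by move=> nm [b b2 FG]; exists b => // /b2 n2; exact: leq_trans n2 nm.
Qed.

Lemma sign_equiv_add P n F F' G G' :
  sign_equiv P n F G -> sign_equiv P n F' G' ->
  sign_equiv P n (fun u j => F u j (+) F' u j) (fun u j => G u j (+) G' u j).
Proof.
move=> [b b2 FG] [c c2 FG']; exists (b (+) c).
  by case: b c b2 c2 {FG FG'} => [] [].
move=> u u01 j Pj; rewrite FG // FG' //.
by case: b c (G u j) (G' u j) {b2 c2 FG FG'} => [] [] [] [].
Qed.

Lemma sign_equiv_sum P n (I : Type) (r : seq I) (F G : I -> R -> J -> bool) :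
  (forall i, sign_equiv P n (F i) (G i)) ->
  sign_equiv P n (fun u j => \sum_(i <- r) F i u j) (fun u j => \sum_(i <- r) G i u j).
Proof.
move=> FG; elim: r => [|i r [b b2 IH]].
  by exists false => // u u01 j _; rewrite !big_nil.
have [c c2 {}FG] := FG i; exists (b (+) c).
  by case: b c b2 c2 {IH FG} => [] [].
move=> u u01 j Pj; rewrite !big_cons IH // FG //.
rewrite -![_ + _]/(_ (+) _); move: (\sum_(i <- r) _) (G i u j) => x y.
by case: b c x y {b2 c2 FG IH} => [] [] [] [].
Qed.

Definition sign_continuous n (T : topologicalType) (phi : T -> R -> J -> bool) : Prop :=
  forall x e, 0 < e -> \forall y \near x,
    exists2 b : bool, (b -> (2 <= n)%N) & step_close e (phi y) (flip b (phi x)).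

Lemma sign_continuous_open n (T : topologicalType) (phi : T -> R -> J -> bool) G e :
  sign_continuous n phi ->
  open [set x | exists2 b : bool, (b -> (2 <= n)%N) & step_close e (phi x) (flip b G)].
Proof.
move=> cphi; rewrite openE => x [b b2 /small_gap[d d0 xG]].
apply: filterS (cphi x d d0) => y [c c2 yx].
exists (c (+) b); first by case: b c b2 c2 {xG yx} => [] [].
by rewrite -(subrKC d e) -flip_flip; apply: step_close_trans yx _; exact: step_close_flip.
Qed.

(** A set is open in the quotient if its preimage is. The preimage of the points close to [phi x] up
    to sign can be written with [psi], since passing from [phi] to [psi] costs only an allowed
    global sign. *)
Lemma sign_continuous_quot n (T : topologicalType) (r : T -> T -> Prop)
    (phi : quot r -> R -> J -> bool) (psi : T -> R -> J -> bool) :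
  (forall x, sign_equiv setT n (phi (cls r x)) (psi x)) ->
  sign_continuous n psi -> sign_continuous n phi.
Proof.
move=> phiE cpsi x e e0.
pose U := [set y | exists2 b : bool, (b -> (2 <= n)%N) &
  step_close e (phi y) (flip b (phi x))].
suff : open U.
  rewrite openE => /(_ x); apply; exists false => //; exact: step_close_refl.
rewrite /open /= /quotient_open.
have := @sign_continuous_open n T psi (phi x) e cpsi; congr open.
apply/seteqP; split => y [b b2 yx]; have [c c2 cE] := phiE y; exists (c (+) b).
- by case: b c b2 c2 {yx cE} => [] [].
- apply: small_sub yx => u [u01 ne]; split => // e1; apply: ne.
  apply/funext => j; rewrite -[LHS]/(phi (cls r y) u j) cE // e1 /flip.
  by rewrite addbA.
- by case: b c b2 c2 {yx cE} => [] [].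
- apply: small_sub yx => u [u01 ne]; split => // e1; apply: ne.
  apply/funext => j; have := cE u u01 j I.
  rewrite -[cls r y]/(\pi_(quot r) y)%qT e1 /flip => /(congr1 (addb c)).
  by rewrite !addbA addbb.
Qed.

Lemma sign_continuous_comp n (S T : topologicalType) (f : S -> T)
    (phi : T -> R -> J -> bool) :
  continuous f -> sign_continuous n phi -> sign_continuous n (phi \o f).
Proof. by move=> cf cphi x e e0; exact: (cf x _ (cphi (f x) e e0)). Qed.

Lemma sign_continuousW n m (T : topologicalType) (phi : T -> R -> J -> bool) :
  (n <= m)%N -> sign_continuous n phi -> sign_continuous m phi.
Proof.
move=> nm cphi x e e0; apply: filterS (cphi x e e0) => y [b b2 yx].
by exists b => // /b2 n2; exact: leq_trans n2 nm.
Qed.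

Lemma sign_continuous_add n (T : topologicalType) (phi psi : T -> R -> J -> bool) :
  sign_continuous n phi -> sign_continuous n psi ->
  sign_continuous n (fun x u j => phi x u j (+) psi x u j).
Proof.
move=> cphi cpsi x e e0; have e20 : 0 < e / 2 by rewrite divr_gt0.
apply: filterS2 (cphi x _ e20) (cpsi x _ e20) => y [b b2 h] [c c2 h'].
exists (b (+) c); first by case: b c b2 c2 {h h'} => [] [].
rewrite [e](splitr e); apply: small_sub (smallU h h') => u [u01 ne].
have [e1|] := pselect (phi y u = flip b (phi x) u); last by left.
have [e2|] := pselect (psi y u = flip c (psi x) u); last by right.
exfalso; apply: ne; apply/funext => j; rewrite e1 e2 /flip.
by case: b c (phi x u j) (psi x u j) {b2 c2 h h' e1 e2} => [] [] [] [].
Qed.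

Lemma sign_continuous_sum n (T : topologicalType) (I : Type) (r : seq I)
    (phi : I -> T -> R -> J -> bool) :
  (forall i, sign_continuous n (phi i)) ->
  sign_continuous n (fun x u j => \sum_(i <- r) phi i x u j).
Proof.
move=> cphi; elim: r => [|i r IH].
  move=> x e e0; near=> y; exists false => //.
  apply: small_sub (small0 e0) => u [_]; apply.
  by apply/funext => j; rewrite /flip !big_nil.
have := sign_continuous_add (cphi i) IH; congr sign_continuous.
apply/funext => x; apply/funext => u; apply/funext => j.
by rewrite big_cons.
Unshelve. all: by end_near. Qed.

Lemma sign_continuous_sigT n (I : choiceType) (X : I -> topologicalType)
    (phi : {i & X i} -> R -> J -> bool) :
  (forall i, sign_continuous n (fun x : X i => phi (existT _ i x))) ->
  sign_continuous n phi.
Proof. by move=> cphi [i x] e e0; exact: (cphi i x e e0). Qed.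
End SignedSteps.

Lemma sign_continuous_reindex (R : realType) (J J' : Type) (f : J' -> J) n
    (T : topologicalType) (phi : T -> R -> J -> bool) :
  sign_continuous n phi -> sign_continuous n (fun x u j => phi x u (f j)).
Proof.
move=> cphi x e e0; apply: filterS (cphi x e e0) => y [b b2 yx]; exists b => //.
apply: small_sub yx => u [u01 ne]; split => // e1; apply: ne.
by apply/funext => j; rewrite e1.
Qed.

Lemma kify_continuous (T : topologicalType) : continuous (fun x : kify T => x : T).
Proof.
apply/continuousP => U oU; rewrite /open /= => K f _ _ cf.
by move/continuousP: cf; exact.
Qed.

(** * Realizations as spaces of step functions *)

(** An equivalence relation that holds on the generators holds on everything they generate, so
    reading [F] on the chosen representative is harmless up to [Q]. *)
Lemma rpr_cls (T : topologicalType) (r : T -> T -> Prop) (X : Type)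
    (Q : X -> X -> Prop) (F : T -> X) :
  (forall x, Q x x) -> (forall x y, Q x y -> Q y x) ->
  (forall x y z, Q x y -> Q y z -> Q x z) ->
  (forall x y, r x y -> Q (F x) (F y)) ->
  forall x, Q (F (rpr (cls r x))) (F x).
Proof.
move=> Qr Qs Qt Qf x.
have : cls r (rpr (cls r x)) = cls r x by exact: rprK.
move=> /eqmodP/asboolP; move: (rpr _) => x'; elim=> [y z|y|y z _|y z w _ yz _].
- exact: Qf.
- exact: Qr.
- exact: Qs.
- exact: Qt yz.
Qed.

Section Times.
Variable R : realType.
Implicit Types (u : R).

Definition partial_sum p (t : simplex R p) (k : nat) : R :=
  \sum_(i < p.+1 | (i < k)%N) \val t 0 i.

Lemma partial_sum0 p (t : simplex R p) : partial_sum t 0 = 0.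
Proof. by rewrite /partial_sum big_pred0. Qed.

Lemma partial_sum_last p (t : simplex R p) : partial_sum t p.+1 = 1.
Proof. by rewrite -(simplex_sum t); apply: eq_bigl => i; rewrite ltn_ord. Qed.

Lemma le_sum_subset p (t : simplex R p) (P Q : pred 'I_p.+1) :
  (forall i, P i -> Q i) -> \sum_(i | P i) \val t 0 i <= \sum_(i | Q i) \val t 0 i.
Proof.
move=> PQ; rewrite [leLHS]big_mkcond [leRHS]big_mkcond; apply: ler_sum => i _.
have := simplex_ge0 t i; case: ifPn => [/PQ ->//|_]; by case: ifP.
Qed.

Lemma le_partial_sum p (t : simplex R p) j k : (j <= k)%N ->
  partial_sum t j <= partial_sum t k.
Proof. by move=> jk; apply: le_sum_subset => i ij; exact: leq_trans ij jk. Qed.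

(** A point of a realization is seen as a step function on [[0, 1)]: the time
    [u] lies in the interval number [interval_at t u], of length the
    corresponding barycentric coordinate. *)
Definition interval_at p (t : simplex R p) u : 'I_p.+1 :=
  odflt ord0 [pick k : 'I_p.+1 | partial_sum t k <= u < partial_sum t k.+1].

Lemma interval_at_unique p (t : simplex R p) u (k k' : nat) :
  partial_sum t k <= u < partial_sum t k.+1 ->
  partial_sum t k' <= u < partial_sum t k'.+1 -> k = k'.
Proof.
move=> /andP[ku uk] /andP[k'u uk']; case: (ltngtP k k') => // kk'.
- by have := le_lt_trans (le_trans (le_partial_sum t kk') k'u) uk; rewrite ltxx.
- by have := le_lt_trans (le_trans (le_partial_sum t kk') ku) uk'; rewrite ltxx.
Qed.

Lemma interval_atP p (t : simplex R p) u : 0 <= u < 1 ->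
  partial_sum t (interval_at t u) <= u < partial_sum t (interval_at t u).+1.
Proof.
move=> /andP[u0 u1]; rewrite /interval_at; case: pickP => [k //|none].
have ex : exists k, u < partial_sum t k.+1 by exists p; rewrite partial_sum_last.
have kp : (ex_minn ex < p.+1)%N.
  by case: ex_minnP => k _; apply; rewrite partial_sum_last.
have := none (Ordinal kp); case: ex_minnP kp => /= k uk kmin kp.
rewrite uk andbT => /negP[]; case: k uk kmin {kp} => [|k] uk kmin.
  by rewrite partial_sum0.
by rewrite leNgt; apply/negP => /kmin; rewrite ltnn.
Qed.

(** A monotone map of vertices merges neighbouring intervals and inserts empty ones. This is what
    makes step functions compatible with the gluing of cells. *)
Lemma interval_at_push p q (f : 'I_p.+1 -> 'I_q.+1) (t : simplex R p) u :
  {homo f : i j / (i <= j)%N} -> 0 <= u < 1 ->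
  interval_at (push f t) u = f (interval_at t u).
Proof.
move=> fmono u01; apply: val_inj; apply: interval_at_unique (interval_atP _ u01) _.
have sumE k : partial_sum (push f t) k = \sum_(i | (f i < k)%N) \val t 0 i.
  rewrite [RHS](partition_big f (fun j => (j < k)%N)) //=.
  apply: eq_bigr => j jk; rewrite mxE; apply: eq_bigl => i.
  by case: eqP => [->|]; rewrite ?jk ?andbF.
rewrite !sumE; have /andP[iu ui] := interval_atP t u01; apply/andP; split.
  apply: le_trans iu; apply: le_sum_subset => i; rewrite !ltnNge.
  by apply: contra; exact: fmono.
apply: lt_le_trans ui _; apply: le_sum_subset => i; rewrite !ltnS.
exact: fmono.
Qed.

Lemma partial_sum_continuous p k : continuous (fun t : simplex R p => partial_sum t k).
Proof.
suff H (r : seq 'I_p.+1) :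
    continuous (fun t : simplex R p => \sum_(i <- r | (i < k)%N) \val t 0 i).
  exact: H.
elim: r => [|i r IH] t.
  rewrite (_ : (fun _ => _) = cst 0); first exact: cst_continuous.
  by apply/funext => t'; rewrite big_nil.
have cval : continuous (fun t : simplex R p => \val t : 'rV[R]_p.+1).
  exact: initial_continuous.
have ci : {for t, continuous (fun t : simplex R p => \val t 0 i)}.
  apply: (@continuous_comp _ _ _ (fun t : simplex R p => \val t : 'rV[R]_p.+1)
    (fun M : 'rV[R]_p.+1 => M 0 i) t (cval t)).
  exact: coord_continuous.
have [ik|ik] := boolP (i < k)%N; last first.
  rewrite (_ : (fun _ => _) =
    (fun t : simplex R p => \sum_(i <- r | (i < k)%N) \val t 0 i)); first exact: IH.
  by apply/funext => t'; rewrite big_cons (negPf ik).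
rewrite (_ : (fun _ => _) = (fun t : simplex R p => \val t 0 i) \+
    (fun t : simplex R p => \sum_(i <- r | (i < k)%N) \val t 0 i)).
  by apply: continuousD => //; exact: IH.
by apply/funext => t'; rewrite big_cons ik.
Qed.

Lemma small_bigcup n (A : nat -> set R) (d : R) : 0 < d ->
  (forall k, (k < n)%N -> small d (A k)) ->
  small (d * n.+1%:R) [set u | exists2 k, (k < n)%N & A k u].
Proof.
move=> d0; elim: n => [|n IH] sA.
  by rewrite mulr1; apply: small_sub (small0 d0) => u [].
rewrite -natr1 mulrDr mulr1; apply: small_sub (smallU (IH _) (sA n _)) => //.
  move=> u [k + Ak]; rewrite ltnS leq_eqVlt => /orP[/eqP <-|kn]; first by right.
  by left; exists k.
by move=> k kn; apply: sA; exact: ltnW.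
Qed.

Lemma interval_at_close p (t : simplex R p) (e : R) : 0 < e -> \forall t' \near t,
  small e [set u | 0 <= u < 1 /\ interval_at t' u <> interval_at t u].
Proof.
(* The index changes only between the old and the new position of one of the [p.+2] endpoints; the
   last share of [e] is the slack of [small_bigcup]. *)
move=> e0; pose d := e / p.+3%:R; have d0 : 0 < d by rewrite divr_gt0.
have dE : d * p.+3%:R = e by rewrite divfK ?pnatr_eq0.
have : \forall t' \near t, forall k : 'I_p.+2,
    `|partial_sum t' k - partial_sum t k| < d.
  apply: (@filter_forall _ 'I_p.+2
    (fun k t' => `|partial_sum t' k - partial_sum t k| < d) (nbhs t) _) => k.
  have /cvgrPdist_lt/(_ d d0) := @partial_sum_continuous p k t.
  by apply: filterS => t'; rewrite distrC.
apply: filterS => t' tt'.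
rewrite -dE; pose A k := [set u | partial_sum t k <= u < partial_sum t' k \/
                                  partial_sum t' k <= u < partial_sum t k].
apply: small_sub (small_bigcup (n := p.+2) (A := A) d0 _); last first.
  by move=> k kp; apply: small_itv => //; exact: (tt' (Ordinal kp)).
move=> u [u01 ne]; have /andP[a b] := interval_atP t u01.
have /andP[c c'] := interval_atP t' u01.
have : interval_at t' u != interval_at t u :> nat by apply: contra_not_neq ne => /val_inj.
rewrite neq_ltn => /orP[] lt.
- exists (interval_at t' u).+1; first by rewrite ltnS ltn_ord.
  by left; rewrite c' andbT; apply: le_trans a; exact: le_partial_sum.
- exists (interval_at t u).+1; first by rewrite ltnS ltn_ord.
  by right; rewrite b andbT; apply: le_trans c; exact: le_partial_sum.
Qed.
End Times.

Lemma coface_homo p (i : 'I_p.+2) : {homo coface i : j k / (j <= k)%N}.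
Proof. by move=> j k; rewrite /= /bump; do 2![case: leqP] => ? ?; lia. Qed.

Lemma codegenE p (i : 'I_p.+1) (k : 'I_p.+2) : codegen i k = unbump i k :> nat.
Proof.
rewrite inordK //; have := ltn_ord i; have := ltn_ord k.
by rewrite /unbump; case: (ltnP i k); lia.
Qed.

Lemma codegen_homo p (i : 'I_p.+1) : {homo codegen i : j k / (j <= k)%N}.
Proof.
by move=> j k; rewrite !codegenE /unbump; do 2![case: ltnP] => ? ?; lia.
Qed.

Section RealizeStep.
Variables (R : realType) (A : sspace) (n : nat).
Variable psi : forall p, A p -> R -> nat -> bool.
Hypothesis psi_face : forall p (i : 'I_p.+2) (a : A p.+1),
  sign_equiv (fun j => j <= p)%N n (psi (face i a)) (fun u j => psi a u (bump i j)).
Hypothesis psi_degen : forall p (i : 'I_p.+1) (a : A p),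
  sign_equiv (fun j => j <= p.+1)%N n (psi (degen i a))
    (fun u j => psi a u (unbump i j)).
Hypothesis psi_continuous : forall p, sign_continuous n (@psi p).

(** The time is used twice: inside the simplex [a], and to select one of its vertices through the
    coordinates [t]. *)
Definition cell_step (c : cells R A) : R -> unit -> bool :=
  let: existT p (a, t) := c in fun u _ => psi a u (interval_at t u).

Definition realize_step (x : realize R A) : R -> unit -> bool := cell_step (rpr x).

Lemma realize_stepE p (a : A p) (t : simplex R p) :
  sign_equiv setT n (realize_step (cls (@glued R A) (cell a t)))
    (fun u _ => psi a u (interval_at t u)).
Proof.
apply: (rpr_cls (Q := sign_equiv setT n) (F := cell_step)).
- exact: sign_equiv_refl.
- exact: sign_equiv_sym.
- exact: sign_equiv_trans.
move=> x y [{}p i {}a {}t|{}p i {}a {}t].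
- have [b b2 E] := psi_face i a; apply: sign_equiv_sym.
  exists b => // u u01 [] _ /=; rewrite E //; last by rewrite -ltnS ltn_ord.
  by rewrite interval_at_push //; exact: coface_homo.
- have [b b2 E] := psi_degen i a; apply: sign_equiv_sym.
  exists b => // u u01 [] _ /=; rewrite E //; last by rewrite -ltnS ltn_ord.
  by rewrite interval_at_push ?codegenE //; exact: codegen_homo.
Qed.

Lemma realize_step_continuous : sign_continuous n realize_step.
Proof.
apply: (sign_continuous_quot (psi := cell_step)).
  by move=> [p [a t]]; exact: realize_stepE.
apply: sign_continuous_sigT => p.
suff H : sign_continuous n
    (fun c : (A p * simplex R p)%type => cell_step (cell c.1 c.2)).
  have := sign_continuous_comp (@kify_continuous (A p * simplex R p)%type) H.
  by congr sign_continuous; apply/funext => -[].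
move=> [a t] e e0; have e20 : 0 < e / 2 by rewrite divr_gt0.
have Ha := psi_continuous a e20; have Ht := interval_at_close t e20.
exists ([set a' | exists2 b : bool, (b -> (2 <= n)%N) &
    step_close (e / 2) (psi a') (flip b (psi a))],
  [set t' | small (e / 2)
    [set u | 0 <= u < 1 /\ interval_at t' u <> interval_at t u]]) => //.
move=> [a' t'] [/= [b b2 aa'] tt']; exists b => //.
rewrite [e](splitr e); apply: small_sub (smallU aa' tt') => u [u01 ne].
have [e1|] := pselect (psi a' u = flip b (psi a) u); last by left.
have [e2|] := pselect (interval_at t' u = interval_at t u); last by right.
by exfalso; apply: ne; apply/funext => j; rewrite /= e1 e2.
Qed.
End RealizeStep.

Section CechStep.
Variable R : realType.

Definition value (Z : choiceType) (x : E R Z) (u : R) : Z :=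
  let: existT p (z, t) := rpr x in z (interval_at t u).

Lemma value_cell (Z : choiceType) p (z : cech Z p) (t : simplex R p) u :
  0 <= u < 1 -> value (cls (@glued R (cech Z)) (cell z t)) u = z (interval_at t u).
Proof.
move=> u01; pose F (c : cells R (cech Z)) : Z :=
  let: existT p (z, t) := c in z (interval_at t u).
apply: (rpr_cls (Q := eq) (F := F)) => //; first by move=> x y z' ->.
move=> x y [{}p i {}z {}t|{}p i {}z {}t] /=; rewrite ffunE interval_at_push //.
- exact: coface_homo.
- exact: codegen_homo.
Qed.

Lemma value_map (Z W : choiceType) (f : Z -> W) (x : E R Z) u :
  0 <= u < 1 -> value (Emap f x) u = f (value x u).
Proof.
rewrite /Emap /realize_map /value => u01; case: (rpr x) => p [z t].
by rewrite -/(value _ u) value_cell // ffunE.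
Qed.

Lemma value_vertex (Z : choiceType) (z : Z) u : 0 <= u < 1 ->
  value (Evertex R z) u = z.
Proof. by move=> u01; rewrite value_cell // ffunE. Qed.

(** The point chosen by [rprod_inv] projects to every [x i], and [value] depends only on the class
    of a cell; so a common subdivision does not alter the values. *)
Lemma value_multi (I : finType) (Z : I -> choiceType) (W : choiceType)
    (g : (forall i, Z i) -> W) (x : forall i, E R (Z i)) u : 0 <= u < 1 ->
  value (Emulti g x) u = g (fun i => value (x i) u).
Proof.
move=> u01; rewrite /Emulti /rprod_inv; case: cid => z /= zx.
rewrite /realize_map; move: zx; rewrite /realize_map; case: (rpr z) => p [a t] ax.
rewrite value_cell // ffunE; congr g; apply: functional_extensionality_dep => i.
by rewrite -ax value_cell.
Qed.

Lemma value_continuous (Z : choiceType) (theta : Z -> bool) :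
  sign_continuous 0 (fun (x : E R Z) u (_ : unit) => theta (value x u)).
Proof.
have := @realize_step_continuous R (cech Z) 0
  (fun p (z : cech Z p) _ j => theta (z (inord j))).
set phi := realize_step _ => cphi.
suff -> : (fun (x : E R Z) u (_ : unit) => theta (value x u)) = phi.
  apply: cphi => [p i z|p i z|p z e e0].
  - exists false => // u _ j jp; rewrite /= ffunE; congr (theta (z _)).
    apply: val_inj => /=; rewrite !inordK // /bump; case: leqP; lia.
  - exists false => // u _ j jp; rewrite /= ffunE; congr (theta (z _)).
    have i_p := ltn_ord i; apply: val_inj => /=.
    by rewrite !inordK // /unbump; move: jp i_p; case: ltnP; lia.
  - near=> z'; have -> : z' = z.
      near: z'; exact: (@discrete_set1 (discrete_topology {ffun 'I_p.+1 -> Z})).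
    by exists false => //; exact: step_close_refl.
apply/funext => x; apply/funext => u; apply/funext => j.
rewrite /phi /realize_step /value /cell_step; case: (rpr x) => p [z t].
by rewrite inord_val.
Unshelve. all: by end_near. Qed.
End CechStep.

(** * Signs on the bar construction *)

Lemma sig_Rank m (k : 'I_m -> nat) (X : Type) (G : forall i, 'I_(k i) -> X) i c :
  G (tagnat.sig1 (tagnat.Rank i c)) (tagnat.sig2 (tagnat.Rank i c)) = G i c.
Proof. by rewrite /tagnat.sig1 /tagnat.sig2 tagnat.rankK. Qed.

Lemma kpair_fst_continuous (A B : topologicalType) :
  continuous (fun c : kpair A B => c.1).
Proof.
move=> c; apply: (continuous_comp (@kify_continuous (A * B)%type c)); exact: cvg_fst.
Qed.

Lemma kpair_snd_continuous (A B : topologicalType) :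
  continuous (fun c : kpair A B => c.2).
Proof.
move=> c; apply: (continuous_comp (@kify_continuous (A * B)%type c)); exact: cvg_snd.
Qed.

Section MonadSign.
Variables (R : realType) (P : top_soperad).
Variable theta : forall m (l : 'I_m -> nat) n, so P l n -> R -> nat -> bool.
Variable sh : nat -> nat.
Hypothesis theta_arity : forall m (l : 'I_m -> nat) n,
  so P l n -> n = (\sum_i l i)%N.
Hypothesis theta_act : forall m (l : 'I_m -> nat) n (s : 'S_m) (p : so P l n) u j,
  0 <= u < 1 -> theta (so_act s p) u j = koszul (odd \o l \o s) s (+) theta p u j.
Hypothesis theta_one : forall n u j, 0 <= u < 1 -> theta (so_one P n) u j = false.
Hypothesis theta_continuous : forall m (l : 'I_m -> nat) n,
  sign_continuous 0 (@theta m l n).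

Lemma arity_le m (l : 'I_m -> nat) n (p : so P l n) i : (l i <= n)%N.
Proof. by rewrite (theta_arity p) (bigD1 i) //= leq_addr. Qed.

Section OneSpace.
Variables (Z : nat -> topologicalType) (psi : forall n, Z n -> R -> nat -> bool).

(** An operation is read at the vertex [j] and its inputs at [sh j]: [sh] is [id] for trees alone
    and [predn] for the product operad, each of whose layers uses up one vertex. *)
Definition word_sign n m (w : word P Z n m) : R -> nat -> bool :=
  let: existT l (p, z) := w in fun u j => theta p u j + \sum_i psi (z i) u (sh j).

Definition monad_sign n (x : monad P Z n) : R -> nat -> bool :=
  word_sign (rpr (tagged x)).

(** Reordering permutes the terms of the inputs and adds a Koszul sign to [theta]. As [n] is the sum
    of the degrees, this sign can be nontrivial only if [2 <= n]. *)
Lemma monad_signE n (m : posn) (l : 'I_(sval m) -> nat) (p : so P l n)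
    (z : forall i, Z (l i)) :
  sign_equiv setT n (monad_sign (mcls p z)) (word_sign (mkword p z)).
Proof.
apply: (rpr_cls (Q := sign_equiv setT n) (F := @word_sign n (sval m))).
- exact: sign_equiv_refl.
- exact: sign_equiv_sym.
- exact: sign_equiv_trans.
move=> _ _ [l0 p0 z0 s].
have ls : (\sum_i (l0 \o s) i = n)%N.
  apply: etrans (esym (theta_arity p0)); apply: esym.
  exact: (reindex_inj (@perm_inj _ s)).
exists (koszul (odd \o l0 \o s) s) => [/koszul_ge2|u u01 j _ /=].
  by rewrite ls.
rewrite theta_act // [X in X + _](_ : _ = koszul (odd \o l0 \o s) s +
  (koszul (odd \o l0 \o s) s + theta p0 u j)); last by rewrite addboolK.
rewrite -![_ (+) _]/(_ + _) -addrA; congr (_ + (_ + _)).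
by rewrite [LHS](reindex_inj (@perm_inj _ s)).
Qed.

Hypothesis psi_continuous : forall n, sign_continuous n (@psi n).

Lemma monad_sign_continuous n : sign_continuous n (@monad_sign n).
Proof.
apply: sign_continuous_sigT => m.
apply: (sign_continuous_quot (psi := @word_sign n (sval m))).
  move=> [l [p z]]; exact: monad_signE.
apply: sign_continuous_sigT => l.
pose A := so P l n; pose B := kprod (fun i => Z (l i)).
suff : sign_continuous n (fun (c : kpair A B) u j =>
    theta c.1 u j (+) \sum_i psi (c.2 i) u (sh j)).
  by congr sign_continuous; apply/funext => -[].
apply: sign_continuous_add.
  apply: (@sign_continuousW _ _ 0) => //.
  apply: (sign_continuous_comp (@kpair_fst_continuous A B)); exact: theta_continuous.
apply: sign_continuous_sum => i -[p z] e e0.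
have li := arity_le p i.
have cB : continuous (fun b : B => b i).
  move=> b; pose T := prod_topology (fun i => Z (l i)).
  exact: (continuous_comp (@kify_continuous T b) (@proj_continuous _ _ i b)).
have ci : continuous (fun c : kpair A B => c.2 i).
  rewrite (_ : (fun c => _) = (fun b : B => b i) \o (fun c : kpair A B => c.2)) //.
  by move=> c; apply: continuous_comp; [exact: kpair_snd_continuous|exact: cB].
have := sign_continuous_comp ci (sign_continuous_reindex sh (@psi_continuous (l i))).
by move=> /(sign_continuousW li)/(_ (p, z) e e0).
Qed.

Lemma munit_sign n (z : Z n) :
  sign_equiv setT n (monad_sign (munit P z)) (fun u j => psi z u (sh j)).
Proof.
apply: sign_equiv_trans (monad_signE _ _) _.
by exists false => // u u01 j _ /=; rewrite theta_one // big_ord1.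
Qed.
End OneSpace.

(** The ambiguity of an input of degree [l i] remains allowed in the result because [l i <= n]. *)
Lemma mmap_sign (Z W : nat -> topologicalType) (psiZ : forall n, Z n -> R -> nat -> bool)
    (psiW : forall n, W n -> R -> nat -> bool) (f : forall n, Z n -> W n)
    (Q Q' : nat -> Prop) (r r' : nat -> nat) :
  (forall n z, sign_equiv Q n (psiW n (f n z)) (fun u j => psiZ n z u (r j))) ->
  (forall j, Q' j -> Q (sh j) /\ sh (r' j) = r (sh j)) ->
  (forall m (l : 'I_m -> nat) n (p : so P l n) u j, Q' j ->
     theta p u j = theta p u (r' j)) ->
  forall n (x : monad P Z n), sign_equiv Q' n (monad_sign psiW (mmap f x))
    (fun u j => monad_sign psiZ x u (r' j)).
Proof.
move=> fE QQ thE n x; rewrite /mmap {2}/monad_sign; case: (rpr _) => l [p z].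
have [b b2 bE] := monad_signE psiW p (fun i => f _ (z i)).
apply: (@sign_equiv_trans _ _ _ _ _ (fun u j => theta p u j +
   \sum_i psiW _ (f _ (z i)) u (sh j))).
  by exists b => // u u01 j _; rewrite bE.
apply: sign_equiv_add.
  by exists false => // u u01 j /thE.
apply: sign_equiv_sum => i.
have [c c2 cE] := fE _ (z i); exists c.
  by move=> /c2 l2; exact: leq_trans l2 (arity_le p i).
by move=> u u01 j /QQ[Qj ->]; exact: cE.
Qed.

(** The vertex [rho j] is the one where the two layers to be merged both act as the merged one does
    at [j]. For the product operad [rho] is [bump 1]: it skips the vertex 1, where the outer layer
    acts through trees and the inner one through permutations. *)
Lemma mmul_sign (Z : nat -> topologicalType) (psi : forall n, Z n -> R -> nat -> bool)
    (rho : nat -> nat) :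
  (forall j, sh (sh (rho j)) = sh j) ->
  (forall m (l : 'I_m -> nat) n (k : 'I_m -> nat) (l' : forall i, 'I_(k i) -> nat)
     (p : so P l n) (q : forall i, so P (l' i) (l i)) u j, 0 <= u < 1 ->
     theta (so_comp p q) u j =
     theta p u (rho j) + \sum_i theta (q i) u (sh (rho j))) ->
  forall n (x : monad P (monad P Z) n),
  sign_equiv setT n (monad_sign psi (mmul x))
    (fun u j => monad_sign (monad_sign psi) x u (rho j)).
Proof.
move=> shE compE n x.
have wE m (l : 'I_m -> nat) (p : so P l n) (k : 'I_m -> nat)
    (w : forall i, word P Z (l i) (k i)) u j : 0 <= u < 1 ->
  word_sign psi (mkword (so_comp p (fun i => (tagged (w i)).1))
      (fun c => (tagged (w (tagnat.sig1 c))).2 (tagnat.sig2 c))) u j =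
  theta p u (rho j) + \sum_i word_sign psi (w i) u (sh (rho j)).
  move=> u01; rewrite [LHS]/= compE // -addrA; congr (_ + _).
  pose F i c := psi _ ((tagged (w i)).2 c) u (sh j).
  transitivity (\sum_i (theta (tagged (w i)).1 u (sh (rho j)) + \sum_c F i c)).
    rewrite big_split; congr (_ + _); rewrite sum_Rank; apply: eq_bigr => i _.
    apply: eq_bigr => c _; exact: (@sig_Rank m k bool F i c).
  apply: eq_bigr => i _; rewrite /F /word_sign; case: (w i) => l' [q z].
  by rewrite shE.
change (sign_equiv setT n (monad_sign psi (mmul x))
  (fun u j => word_sign (monad_sign psi) (rpr (tagged x)) u (rho j))).
rewrite /mmul; case: (rpr (tagged x)) => l [p y].
apply: sign_equiv_trans (monad_signE _ _ _) _.
by exists false => // u u01 j _; exact: wE.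
Qed.
End MonadSign.

(** * Signs of the monads and of the algebra X *)

Section ThetaSigns.
Variable R : realType.
Let EM : top_soperad := Esoperad R Mset_soperad.
Let DEM : top_soperad := prod_soperad (Esoperad R Dset_soperad) EM.

Definition theta_M m (l : 'I_m -> nat) n (p : so EM l n) (u : R) (j : nat) : bool :=
  tree_sign (value p u).

Definition theta_N m (l : 'I_m -> nat) n (p : so DEM l n) (u : R) (j : nat) : bool :=
  if j is 0 then perm_sign (value p.1 u) else tree_sign (value p.2 u).

Lemma theta_M_arity m (l : 'I_m -> nat) n : so EM l n -> n = (\sum_i l i)%N.
Proof. by move=> p; exact: Mset_arity (value p 0). Qed.

Lemma theta_N_arity m (l : 'I_m -> nat) n : so DEM l n -> n = (\sum_i l i)%N.
Proof. by move=> p; exact: (theta_M_arity p.2). Qed.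

Lemma theta_M_act m (l : 'I_m -> nat) n (s : 'S_m) (p : so EM l n) u j :
  0 <= u < 1 -> theta_M (so_act s p) u j = koszul (odd \o l \o s) s (+) theta_M p u j.
Proof. by move=> u01; rewrite /theta_M /= value_map // tree_sign_act. Qed.

Lemma theta_N_act m (l : 'I_m -> nat) n (s : 'S_m) (p : so DEM l n) u j :
  0 <= u < 1 -> theta_N (so_act s p) u j = koszul (odd \o l \o s) s (+) theta_N p u j.
Proof.
move=> u01; rewrite /theta_N /=; case: j => [|j]; rewrite value_map //.
  exact: perm_sign_act.
exact: tree_sign_act.
Qed.

Lemma theta_N_one n u j : 0 <= u < 1 -> theta_N (so_one DEM n) u j = false.
Proof.
move=> u01; rewrite /theta_N /=; case: j => [|j]; rewrite value_vertex //.
  exact: perm_sign_one.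
exact: tree_sign_corolla1.
Qed.

Lemma theta_M_continuous m (l : 'I_m -> nat) n :
  sign_continuous 0 (@theta_M m l n).
Proof.
have := value_continuous (R := R) (@tree_sign m l n).
by move=> /(sign_continuous_reindex (fun _ : nat => tt)).
Qed.

Lemma theta_N_continuous m (l : 'I_m -> nat) n :
  sign_continuous 0 (@theta_N m l n).
Proof.
have c1 := sign_continuous_comp (@kpair_fst_continuous _ _)
  (value_continuous (R := R) (@perm_sign m l n)).
have c2 := sign_continuous_comp (@kpair_snd_continuous _ _)
  (value_continuous (R := R) (@tree_sign m l n)).
move=> p e e0; have e20 : 0 < e / 2 by rewrite divr_gt0.
apply: filterS2 (c1 _ p _ e20) (c2 _ p _ e20) => q [b b2 h] [c c2' h'].
exists false => //; have {b2}b0 : b = false by case: b b2 {h} => // /(_ isT).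
have {c2'}c0 : c = false by case: c c2' {h'} => // /(_ isT).
rewrite [e](splitr e); apply: small_sub (smallU h h') => u [u01 ne]; subst b c.
have [e1|] := pselect ((fun _ : unit => perm_sign (value q.1 u)) =
                        flip false (fun u _ => perm_sign (value p.1 u)) u); last by left.
have [e2|] := pselect ((fun _ : unit => tree_sign (value q.2 u)) =
                        flip false (fun u _ => tree_sign (value p.2 u)) u); last by right.
exfalso; apply: ne; apply/funext => -[|j].
  exact: (congr1 (fun f => f tt) e1).
exact: (congr1 (fun f => f tt) e2).
Qed.

Lemma theta_M_comp m (l : 'I_m -> nat) n (k : 'I_m -> nat)
    (l' : forall i, 'I_(k i) -> nat) (p : so EM l n)
    (q : forall i, so EM (l' i) (l i)) u j : 0 <= u < 1 ->
  theta_M (so_comp p q) u j = theta_M p u j + \sum_i theta_M (q i) u j.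
Proof. by move=> u01; rewrite /theta_M /= value_multi // tree_sign_comp. Qed.

Lemma theta_N_comp m (l : 'I_m -> nat) n (k : 'I_m -> nat)
    (l' : forall i, 'I_(k i) -> nat) (p : so DEM l n)
    (q : forall i, so DEM (l' i) (l i)) u j : 0 <= u < 1 ->
  theta_N (so_comp p q) u j =
  theta_N p u (bump 1 j) + \sum_i theta_N (q i) u (bump 1 j).-1.
Proof.
move=> u01; rewrite /theta_N; case: j => [|j]; rewrite /= value_multi //.
  by rewrite perm_sign_comp.
by rewrite tree_sign_comp.
Qed.

Definition BSym_sign n (x : BSym R n) (u : R) (j : nat) : bool :=
  koszul (fun=> true) (value (rpr x) u).

(** Left translation by [s] adds the sign of [s], the same at all times. *)
Lemma BSym_signE n (e : E R 'S_n) :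
  sign_equiv setT n (BSym_sign (cls (@symrel R n) e))
    (fun u _ => koszul (fun=> true) (value e u)).
Proof.
apply: (rpr_cls (Q := sign_equiv setT n)
  (F := fun (e : E R 'S_n) u (j : nat) => koszul (fun=> true) (value e u))).
- exact: sign_equiv_refl.
- exact: sign_equiv_sym.
- exact: sign_equiv_trans.
move=> _ _ [x s]; exists (koszul (fun=> true) s) => [|u u01 j _].
  by move=> /(koszul_ge2 (l := fun=> 1%N)); rewrite sum1_card card_ord.
rewrite value_map // (koszulM (fun=> true)) -[_ (+) _]/(_ + _).
by rewrite addboolK.
Qed.

Lemma BSym_sign_continuous n : sign_continuous n (@BSym_sign n).
Proof.
apply: (sign_continuous_quot (psi := fun (e : E R 'S_n) u (j : nat) =>
  koszul (fun=> true) (value e u))); first exact: BSym_signE.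
apply: (@sign_continuousW _ _ 0) => //.
have := value_continuous (R := R) (fun s : 'S_n => koszul (fun=> true) s).
by move=> /(sign_continuous_reindex (fun _ : nat => tt)).
Qed.

(** The action on X is block composition, so [koszul_block_comp] applies with [l i] inputs of degree
    one in the block [i]. It speaks of permutations only, hence the restriction to the vertex 0. *)
Lemma BSym_sign_act n (x : monad DEM (BSym R) n) :
  sign_equiv (fun j => j <= 0)%N n (BSym_sign (X_act x))
    (monad_sign theta_N predn BSym_sign x).
Proof.
rewrite /X_act /malg.
change (sign_equiv (fun j => j <= 0)%N n
  (BSym_sign (let: existT l (p, z) := rpr (tagged x) in Dtheta p.1 z))
  (word_sign theta_N predn BSym_sign (rpr (tagged x)))).
case: (rpr (tagged x)) => l [p z]; rewrite /Dtheta.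
set eq_n := esym _; move: eq_n.
have ecastE k k' (e : k = k') (y : BSym R k) :
    BSym_sign (ecast k' (BSym R k') e y) = BSym_sign y by case: _ / e.
move=> eq_n; rewrite ecastE /BSym_act.
have [b b2 bE] := BSym_signE (be_comp (Emap sval p.1) (fun i => rpr (z i))).
exists b => [/b2|u u01 j]; first by rewrite eq_n.
rewrite leqn0 => /eqP -> ; rewrite bE // value_multi // koszul_block_comp.
rewrite value_map //; congr (_ (+) (_ + _)).
by apply: eq_koszul => i; rewrite sum_true.
Qed.
End ThetaSigns.

(** * Faces, degeneracies and points of the bar construction *)

Section XiSigns.
Variable R : realType.
Let EM : top_soperad := Esoperad R Mset_soperad.
Let DEM : top_soperad := prod_soperad (Esoperad R Dset_soperad) EM.

(** [NX_sign q y u j] is the sign of [y] at the time [u] and at the vertex [j] of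
    the [q]-simplices of the bar construction, where the [j] outer copies of [N]
    act through the trees and the other ones through [D] and its action on
    [X]. *)
Fixpoint NX_sign q : forall n, NX R q n -> R -> nat -> bool :=
  match q return forall n, NX R q n -> R -> nat -> bool with
  | 0 => @BSym_sign R
  | q'.+1 => monad_sign (@theta_N R) predn (@NX_sign q')
  end.

Definition bar_sign n q (a : bar R n q) : R -> nat -> bool :=
  monad_sign (@theta_M R) id (@NX_sign q) a.

Lemma NX_sign_continuous q n : sign_continuous n (@NX_sign q n).
Proof.
elim: q n => [|q IH] n; first exact: BSym_sign_continuous.
apply: monad_sign_continuous IH n.
- exact: theta_N_arity.
- exact: theta_N_act.
- exact: theta_N_continuous.
Qed.

Lemma bar_sign_continuous n q : sign_continuous n (@bar_sign n q).
Proof.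
apply: monad_sign_continuous.
- exact: theta_M_arity.
- exact: theta_M_act.
- exact: theta_M_continuous.
- exact: NX_sign_continuous.
Qed.

(** The shift to [j.+1] is due to the face 0 of the bar construction, which merges the outermost
    layer into the trees and is not seen on [NX]. *)
Lemma NXface_sign q j : (j <= q)%N -> forall n (x : monad DEM (NX R q) n),
  sign_equiv (fun k => k <= q)%N n (NX_sign (@NXface R q j n x))
    (fun u k => @NX_sign q.+1 n x u (bump j.+1 k)).
Proof.
elim: q j => [|q IH] [|j] // jq n x.
- have [b b2 bE] := BSym_sign_act x; exists b => // u u01 k k0.
  apply: etrans (bE u u01 k k0) _.
  by rewrite (_ : bump 1 k = k) // /bump; move: k0; case: k.
- have [b b2 bE] := @mmul_sign R DEM (@theta_N R) predn
    (@theta_N_arity R) (@theta_N_act R) (NX R q) (@NX_sign q) (bump 1) (fun j => ltac:(by case: j))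
    (@theta_N_comp R) n x.
  by exists b => // u u01 k _; exact: bE.
- have H := @mmap_sign R DEM (@theta_N R) predn (@theta_N_arity R) (@theta_N_act R)
    (monad DEM (NX R q)) (NX R q) (@NX_sign q.+1) (@NX_sign q) (@NXface R q j)
    (fun k => k <= q)%N (fun k => k <= q.+1)%N (bump j.+1) (bump j.+2) _ _ _ n x.
  apply: H => [n' z|k kq|m l n' p u k _].
  + exact: IH.
  + by case: k kq => [|k] kq; split => //=; rewrite /bump; case: leqP => ?; lia.
  + by case: k => // k; rewrite /bump; case: leqP.
Qed.

Let unbumpS j k : unbump j.+1 k.+1 = (unbump j k).+1.
Proof. by rewrite /unbump ltnS subSn //; case: k => // k; case: (_ < _)%N. Qed.

Lemma NXdegen_sign q j n (x : NX R q n) : (j <= q)%N ->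
  sign_equiv setT n (@NX_sign q.+1 n (@NXdegen R q j n x))
    (fun u k => NX_sign x u (unbump j k)).
Proof.
have unitE q' (Z := NX R q') n' (z : Z n') :
    sign_equiv setT n' (monad_sign (@theta_N R) predn (@NX_sign q') (munit DEM z))
      (fun u k => NX_sign z u (unbump 0 k)).
  have [b b2 bE] := @munit_sign R DEM (@theta_N R) predn (@theta_N_arity R)
    (@theta_N_act R) (@theta_N_one R) Z (@NX_sign q') n' z.
  exists b => // u u01 k _; rewrite bE //; congr (_ (+) NX_sign _ _ _).
  by rewrite /unbump; case: k => //= k; rewrite subn1.
elim: q j n x => [|q IH] [|j] n x jq.
- exact: (unitE 0).
- by move: jq; rewrite ltn0.
- exact: (unitE q.+1).
have H := @mmap_sign R DEM (@theta_N R) predn (@theta_N_arity R) (@theta_N_act R)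
    (NX R q) (monad DEM (NX R q)) (@NX_sign q) (@NX_sign q.+1) (@NXdegen R q j)
    setT setT (unbump j) (unbump j.+1) _ _ _ n x.
apply: H => [n' z|k _|m l n' p u k _].
- exact: IH.
- by split => //; case: k => [|k] //; rewrite unbumpS.
- by case: k => // k; rewrite unbumpS.
Qed.

(** Forgetting the permutations leaves the outermost layer acting through trees, which it does at
    every vertex but 0; the face 0 omits exactly that vertex. *)
Lemma monad_proj_sign q n (x : monad DEM (NX R q) n) :
  sign_equiv setT n (monad_sign (@theta_M R) id (@NX_sign q) (monad_proj x))
    (fun u k => @NX_sign q.+1 n x u k.+1).
Proof.
change (sign_equiv setT n (monad_sign (@theta_M R) id (@NX_sign q) (monad_proj x))
    (fun u k => word_sign (@theta_N R) predn (@NX_sign q) (rpr (tagged x)) u k.+1)).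
rewrite /monad_proj; case: (rpr (tagged x)) => l [p z].
exact: monad_signE (@theta_M_arity R) (@theta_M_act R) _ _ _ _ _ _ _.
Qed.

Lemma bar_face n q (i : 'I_q.+2) (a : bar R n q.+1) :
  sign_equiv (fun k => k <= q)%N n (@bar_sign n q (face i a))
    (fun u k => @bar_sign n q.+1 a u (bump i k)).
Proof.
case: i => -[|j] jq /=.
  have [b b2 bE] := @mmul_sign R EM (@theta_M R) id (@theta_M_arity R) (@theta_M_act R)
    (NX R q) (@NX_sign q) id (fun=> erefl) (@theta_M_comp R) n
    (mmap (@monad_proj R (NX R q)) a).
  apply: (@sign_equiv_trans _ _ _ _ _ (monad_sign (@theta_M R) id
    (monad_sign (@theta_M R) id (@NX_sign q)) (mmap (@monad_proj R (NX R q)) a))).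
    by exists b => // u u01 k _; exact: bE.
  apply: (@mmap_sign R EM (@theta_M R) id (@theta_M_arity R) (@theta_M_act R)
    (monad DEM (NX R q)) (monad EM (NX R q)) (@NX_sign q.+1)
    (monad_sign (@theta_M R) id (@NX_sign q)) (@monad_proj R (NX R q)) setT
    (fun k => k <= q)%N (bump 0) (bump 0)) => // n' z.
  exact: monad_proj_sign.
apply: (@mmap_sign R EM (@theta_M R) id (@theta_M_arity R) (@theta_M_act R)
    (monad DEM (NX R q)) (NX R q) (@NX_sign q.+1) (@NX_sign q) (@NXface R q j)
    (fun k => k <= q)%N (fun k => k <= q)%N (bump j.+1) (bump j.+1)) => // n' z.
exact: NXface_sign.
Qed.

Lemma bar_degen n q (i : 'I_q.+1) (a : bar R n q) :
  sign_equiv (fun k => k <= q.+1)%N n (@bar_sign n q.+1 (degen i a))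
    (fun u k => @bar_sign n q a u (unbump i k)).
Proof.
apply: (@mmap_sign R EM (@theta_M R) id (@theta_M_arity R) (@theta_M_act R)
    (NX R q) (monad DEM (NX R q)) (@NX_sign q) (@NX_sign q.+1) (@NXdegen R q i)
    setT (fun k => k <= q.+1)%N (unbump i) (unbump i)) => // n' z.
by apply: NXdegen_sign; rewrite -ltnS.
Qed.

Definition Xi_step n (x : Xi_space R n) : R -> unit -> bool :=
  realize_step (@bar_sign n) x.

Lemma Xi_step_continuous n : sign_continuous n (@Xi_step n).
Proof.
apply: realize_step_continuous.
- exact: bar_face.
- exact: bar_degen.
- exact: bar_sign_continuous.
Qed.

Lemma Xi_stepE n q (a : bar R n q) (t : simplex R q) :
  sign_equiv setT n (Xi_step (cls (@glued R (bar R n)) (cell a t)))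
    (fun u _ => bar_sign a u (interval_at t u)).
Proof. by apply: realize_stepE; [exact: bar_face|exact: bar_degen]. Qed.

(** A common subdivision gives all inputs the same coordinates, hence the same vertex at each time,
    and there the signs add. *)
Lemma Xi_EMact_step (m : posn) (l : 'I_(sval m) -> nat) n (e : so EM l n)
    (x : forall i, Xi_space R (l i)) :
  sign_equiv setT n (Xi_step (Xi_EMact e x))
    (fun u _ => tree_sign (value e u) + \sum_i Xi_step (x i) u tt).
Proof.
rewrite /Xi_EMact /rprod_inv; case: cid => z /=.
rewrite /realize_map; case: (rpr z) => q [y t] xE.
apply: sign_equiv_trans (Xi_stepE _ _) _.
have [b b2 bE] := @mmul_sign R EM (@theta_M R) id (@theta_M_arity R) (@theta_M_act R)
    (NX R q) (@NX_sign q) id (fun=> erefl) (@theta_M_comp R) n (mcls e y).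
have [c c2 cE] := @monad_signE R EM (@theta_M R) id (@theta_M_arity R) (@theta_M_act R)
    (monad EM (NX R q)) (monad_sign (@theta_M R) id (@NX_sign q)) n m l e y.
apply: (@sign_equiv_trans _ _ _ _ _ (fun u _ => tree_sign (value e u) +
    \sum_i bar_sign (y i) u (interval_at t u))).
  exists (b (+) c); first by case: b c b2 c2 {bE cE} => [] [].
  move=> u u01 j _; apply: etrans (bE u u01 _ I) _.
  by rewrite -addbA; congr (_ (+) _); exact: cE.
apply: sign_equiv_add; first exact: sign_equiv_refl.
apply: sign_equiv_sum => i; apply: sign_equiv_sym.
apply: (@sign_equivW _ _ _ (l i)); first exact: (arity_le (@theta_M_arity R) e i).
rewrite -xE; have [d d2 dE] := Xi_stepE (y i) t.
by exists d => // u u01 j _; exact: (dE u u01 tt I).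
Qed.

Lemma Xi_act_step n (x : Xi R n) (s : 'S_n.+1) :
  sign_equiv setT n (Xi_step (oact x s : Xi R n))
    (fun u _ => tree_sign (corolla s) + Xi_step x u tt).
Proof.
apply: sign_equiv_trans (Xi_EMact_step _ _) _.
by exists false => // u u01 j _; rewrite value_vertex // big_ord1.
Qed.

Lemma Xi_comp_step n m (x : Xi R n) (i : 'I_n.+1) (y : Xi R m) :
  exists b : bool, forall u, 0 <= u < 1 ->
    Xi_step (ocomp x i y : Xi R (n + m)) u tt = b + (Xi_step x u tt + Xi_step y u tt).
Proof.
have [b b2 bE] := @Xi_EMact_step posn2 (sorts2 n m) (n + m) (Evertex R (graft m i))
  (pair2 x y).
exists (b + tree_sign (graft m i)) => u u01.
apply: etrans (bE u u01 tt I) _.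
rewrite value_vertex // -[b (+) _]/(b + _) -[RHS]addrA.
set w := tree_sign _; congr (b + (w + _)).
transitivity (\sum_(b < 2) Xi_step (pair2 (Z := Xi R) x y b) u tt) => //.
by rewrite big_ord_recl big_ord1; exact: erefl.
Qed.
End XiSigns.

(** * Lifting signs over contractible spaces *)

Section Lifting.
Variables (R : realType) (J : Type) (j0 : J).
Implicit Types F G H : R -> J -> bool.

Definition sign_close n (e : R) F G : Prop :=
  exists2 b : bool, (b -> (2 <= n)%N) & step_close e F (flip b G).

Lemma sign_close_trans n e e' F G H :
  sign_close n e F G -> sign_close n e' G H -> sign_close n (e + e') F H.
Proof.
move=> [b b2 FG] [c c2 GH]; exists (b (+) c); first by case: b c b2 c2 {FG GH} => [] [].
by rewrite -flip_flip; apply: step_close_trans FG _; exact: step_close_flip.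
Qed.

Lemma sign_close_sym n e F G : sign_close n e F G -> sign_close n e G F.
Proof.
by move=> [b b2 FG]; exists b => //; apply: step_close_flipLR; exact: step_close_sym.
Qed.

(** Meaningful only if [F] and [G] are close up to sign. *)
Definition relative_sign F G : bool := ~~ `[< step_close (1 / 4) F G >].

(** If [F] were within 1/4 of both [G] and its opposite, these would be within 1/2 of each other,
    whereas they differ everywhere. *)
Lemma relative_signP b F G : step_close (1 / 4) F (flip b G) -> relative_sign F G = b.
Proof.
rewrite /relative_sign; case: b => FG; last by rewrite asboolT.
rewrite asboolF // => FG'; have := step_close_trans (step_close_sym FG) FG'.
move=> /(step_closeW (e' := 1)) H.
by have /(step_close_flip_inj j0) : step_close 1 (flip true G) (flip false G)
  by apply: H; lra.
Qed.

Lemma relative_sign_trans n F G H :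
  sign_close n (1 / 8) F G -> sign_close n (1 / 8) G H ->
  relative_sign F H = relative_sign F G + relative_sign G H.
Proof.
move=> [b _ FG] [c _ GH].
have -> : relative_sign F G = b by apply: relative_signP; apply: step_closeW FG; lra.
have -> : relative_sign G H = c by apply: relative_signP; apply: step_closeW GH; lra.
apply: relative_signP; rewrite -[b + c]/(b (+) c) -flip_flip.
have -> : 1 / 4 = 1 / 8 + 1 / 8 :> R by lra.
by apply: step_close_trans FG _; exact: step_close_flip.
Qed.

Lemma relative_sign_refl F : relative_sign F F = false.
Proof. by apply: relative_signP; rewrite flip0; apply: step_close_refl; lra. Qed.

Definition dyadic (N k : nat) : R := k%:R * 2^-1 ^+ N.

Lemma dyadic0 N : dyadic N 0 = 0.
Proof. exact: mul0r. Qed.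

Lemma dyadic_top N : dyadic N (2 ^ N)%N = 1.
Proof. by rewrite /dyadic natrX exprVn divff // expf_neq0 // pnatr_eq0. Qed.

Lemma mesh_ge0 N : 0 <= 2^-1 ^+ N :> R.
Proof. by rewrite exprn_ge0 // invr_ge0. Qed.

Lemma dyadic01 N k : (k <= 2 ^ N)%N -> 0 <= dyadic N k <= 1.
Proof.
move=> kN; rewrite mulr_ge0 ?mesh_ge0 //= -(dyadic_top N).
by rewrite ler_wpM2r ?mesh_ge0 // ler_nat.
Qed.

Lemma dyadic_step N k : `|dyadic N k - dyadic N k.+1| <= 2^-1 ^+ N.
Proof.
rewrite /dyadic -mulrBl -natr1 opprD addrA subrr add0r mulN1r normrN.
by rewrite ger0_norm // mesh_ge0.
Qed.

Lemma dyadic_double N k : dyadic N.+1 k.*2 = dyadic N k.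
Proof.
rewrite /dyadic -muln2 natrM exprS mulrA -[_ * 2 * _]mulrA.
by rewrite divff ?mulr1 ?pnatr_eq0.
Qed.

Lemma mesh_le N M : (N <= M)%N -> 2^-1 ^+ M <= 2^-1 ^+ N :> R.
Proof.
by move=> NM; apply: ler_wiXn2l NM; rewrite ?invr_ge0 // invf_le1 // ler1n.
Qed.

Section Contraction.
Variables (n : nat) (T : topologicalType) (phi : T -> R -> J -> bool).
Variables (x0 : T) (contraction : T * R -> T).
Hypothesis phi_continuous : sign_continuous n phi.
Hypothesis contraction_continuous :
  {within [set: T] `*` `[0, 1]%classic, continuous contraction}.
Hypothesis contraction0 : forall x, contraction (x, 0) = x.
Hypothesis contraction1 : forall x, contraction (x, 1) = x0.

Let q x s := phi (contraction (x, s)).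

Lemma contraction_tube x e : 0 < e -> exists N, \forall y \near x,
  forall s s', 0 <= s <= 1 -> 0 <= s' <= 1 -> `|s - s'| <= 2^-1 ^+ N ->
  sign_close n e (q y s') (q x s).
Proof.
move=> e0; have e20 : 0 < e / 2 by rewrite divr_gt0.
pose P (i : nat * T) (s : R) := forall s', 0 <= s' <= 1 -> `|s - s'| <= 2^-1 ^+ i.1 ->
  sign_close n e (q i.2 s') (q x s).
have /compact_near_coveringP/near_covering_withinP cov := @segment_compact R 0 1.
have covP (s0 : R) : `[0, 1]%classic s0 ->
    \forall s \near s0 & i \near filter_prod \oo (nbhs x), `[0, 1]%classic s -> P i s.
  rewrite /= in_itv /= => s01.
  have cs : contraction @ within ([set: T] `*` `[0, 1]%classic) (nbhs (x, s0)) -->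
      contraction (x, s0).
    by move/subspace_continuousP: contraction_continuous; apply; split.
  have [[U V] /= [Ux /nbhs_ballP[d /= d0 dV]] UV] :=
    cs _ (phi_continuous (contraction (x, s0)) e20).
  have d20 : 0 < d / 2 by rewrite divr_gt0.
  have near_s0 (y : T) (s' : R) : U y -> 0 <= s' <= 1 -> `|s0 - s'| < d ->
      sign_close n (e / 2) (q y s') (q x s0).
    move=> Uy s'01 s's0; apply: (UV (y, s')); last by split => //=; rewrite in_itv.
    by split => //; exact: dV.
  exists (ball s0 (d / 2), [set i : nat * T | 2^-1 ^+ i.1 < d / 2 /\ U i.2]).
    split; first exact: nbhsx_ballx.
    exists ([set N | 2^-1 ^+ N < d / 2], U) => //; split => //=.
    have h : `|2^-1 : R| < 1 by rewrite ger0_norm ?invr_ge0 // invf_lt1 // ltr1n.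
    have /cvgr0_norm_lt/(_ _ d20) := cvg_expr h.
    by apply: filterS => N; rewrite ger0_norm // exprn_ge0 // invr_ge0.
  move=> [s [N y]] /= [ss0 [Nd Uy]]; rewrite in_itv /= => s_01 s' s'01 ss'.
  rewrite [e](splitr e); apply: sign_close_trans (near_s0 y s' Uy s'01 _) _.
    apply: le_lt_trans (ler_distD s _ _) _; rewrite [d](splitr d).
    by apply: ltrD ss0 _; exact: le_lt_trans ss' Nd.
  apply: sign_close_sym; apply: near_s0 => //; first exact: nbhs_singleton.
  by apply: lt_trans ss0 _; lra.
have [[A B] /= [[N _ NA] Bx] AB] := cov _ _ _ _ covP.
exists N; apply: filterS Bx => y By s s' s01 s'01 ss'.
have ANB : (A `*` B) (N, y) by split => //; apply: NA => /=.
by apply: (AB (N, y) ANB s) => //; rewrite /= in_itv.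
Qed.

(** The sign picked up along the path from [x] to [x0] traced by the contraction, in [2 ^ N]
    steps. *)
Let monodromy N x : bool :=
  \sum_(0 <= k < 2 ^ N) relative_sign (q x (dyadic N k)) (q x (dyadic N k.+1)).

Let tame N x := forall s s', 0 <= s <= 1 -> 0 <= s' <= 1 ->
  `|s - s'| <= 2^-1 ^+ N -> sign_close n (1 / 8) (q x s') (q x s).

Let sum_double (F : nat -> bool) m :
  \sum_(0 <= k < m.*2) F k = \sum_(0 <= k < m) (F k.*2 + F k.*2.+1).
Proof.
elim: m => [|m IH]; first by rewrite !big_geq.
by rewrite doubleS !big_nat_recr //= IH addrA.
Qed.

Let tameS N x : tame N x -> tame N.+1 x.
Proof.
by move=> tN s s' s01 s'01 ss'; apply: tN => //; exact: le_trans ss' (mesh_le (leqnSn N)).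
Qed.

Let monodromyS N x : tame N x -> monodromy N.+1 x = monodromy N x.
Proof.
move=> tN; rewrite /monodromy expnS mul2n sum_double.
rewrite big_nat [RHS]big_nat; apply: eq_bigr => k /andP[_ kN].
have adj i : (i.+1 <= 2 ^ N.+1)%N ->
    sign_close n (1 / 8) (q x (dyadic N.+1 i)) (q x (dyadic N.+1 i.+1)).
  move=> iN; apply: (tameS tN); rewrite ?dyadic01 // 1?ltnW //.
  by rewrite distrC; exact: dyadic_step.
have k2 : (k.*2.+2 <= 2 ^ N.+1)%N by rewrite -doubleS expnS mul2n leq_double.
rewrite -(dyadic_double N k) -(dyadic_double N k.+1) doubleS.
by rewrite (relative_sign_trans (adj _ (ltnW k2)) (adj _ k2)).
Qed.

Let monodromy_stable N M x : tame N x -> (N <= M)%N -> monodromy M x = monodromy N x.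
Proof.
move=> tN NM; rewrite -(subnK NM); elim: (M - N)%N => [//|d IH].
rewrite addSn monodromyS //; elim: d {IH} => [//|d]; rewrite addSn; exact: tameS.
Qed.

(** Each square between the two paths commutes by [relative_sign_trans], so the monodromies differ
    by the two extreme rungs; the last rung is trivial as both paths end at [x0]. *)
Let ladder N x y :
  (forall s s', 0 <= s <= 1 -> 0 <= s' <= 1 -> `|s - s'| <= 2^-1 ^+ N ->
     sign_close n (1 / 8) (q y s') (q x s)) ->
  tame N x -> tame N y ->
  monodromy N y = monodromy N x + relative_sign (phi y) (phi x).
Proof.
move=> yx tx ty; apply: (@addrI _ (monodromy N x)); rewrite addboolK.
pose r k := relative_sign (q y (dyadic N k)) (q x (dyadic N k)).
have -> : relative_sign (phi y) (phi x) = r 0%N.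
  by rewrite /r dyadic0 /q !contraction0.
have rN : r (2 ^ N)%N = 0 by rewrite /r dyadic_top /q !contraction1 relative_sign_refl.
rewrite -[RHS]addr0 -rN /monodromy.
have : forall m, (m <= 2 ^ N)%N ->
  \sum_(0 <= k < m) relative_sign (q x (dyadic N k)) (q x (dyadic N k.+1)) +
  \sum_(0 <= k < m) relative_sign (q y (dyadic N k)) (q y (dyadic N k.+1)) = r 0%N + r m.
  elim=> [|m IH] mN; first by rewrite !big_geq // addbool.
  rewrite !big_nat_recr //= addrACA IH 1?ltnW //.
  have m0 : (m <= 2 ^ N)%N by exact: ltnW.
  have near0 k : (k <= 2 ^ N)%N ->
      sign_close n (1 / 8) (q y (dyadic N k)) (q x (dyadic N k)).
    by move=> kN; apply: yx; rewrite ?dyadic01 // subrr normr0 mesh_ge0.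
  have xm : sign_close n (1 / 8) (q x (dyadic N m)) (q x (dyadic N m.+1)).
    by apply: tx; rewrite ?dyadic01 // distrC dyadic_step.
  have ym : sign_close n (1 / 8) (q y (dyadic N m)) (q y (dyadic N m.+1)).
    by apply: ty; rewrite ?dyadic01 // distrC dyadic_step.
  have e1 := relative_sign_trans (near0 _ m0) xm.
  have e2 := relative_sign_trans ym (near0 _ mN).
  have := etrans (esym e1) e2; rewrite -/(r _) -/(r _).
  move: (r 0%N) (r m) (r m.+1) (relative_sign (q x _) _) (relative_sign (q y _) _).
  by do 5!case.
by move=> /(_ _ (leqnn _)) ->.
Qed.

(** Transport along the contraction trivializes the double covering of the local
    choices of signs. *)
Lemma sign_lift : exists chi : T -> bool,
  sign_continuous 0 (fun x => flip (chi x) (phi x)).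
Proof.
have e8 : 0 < 1 / 8 :> R by lra.
have tube x := cid (contraction_tube x e8).
pose N x := sval (tube x).
have Nnear x := svalP (tube x).
have tN x : tame (N x) x by exact: nbhs_singleton (Nnear x).
exists (fun x => monodromy (N x) x) => x e e0.
(* The bound 1/8 identifies [b] with the relative sign, the bound [e] is the closeness to be
   reached. *)
pose d := Num.min e (1 / 8); have d0 : 0 < d by rewrite lt_min e0 e8.
apply: filterS2 (Nnear x) (phi_continuous x d0) => y yx [b b2 byx]; exists false => //.
(* The lifts at [x] and [y] use different meshes; refining to a common one changes neither
   monodromy. *)
pose M := maxn (N x) (N y).
have tameM z : (N z <= M)%N -> tame M z.
  by move=> zM s s' s01 s'01 ss'; apply: (tN z) => //; exact: le_trans ss' (mesh_le zM).
have lad : monodromy M y = monodromy M x + relative_sign (phi y) (phi x).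
  apply: ladder; try (by apply: tameM; rewrite ?leq_maxl ?leq_maxr).
  move=> s s' s01 s'01 ss'; apply: yx => //.
  exact: le_trans ss' (mesh_le (leq_maxl _ _)).
rewrite -(monodromy_stable (tN x) (leq_maxl _ (N y))).
rewrite -(monodromy_stable (tN y) (leq_maxr (N x) _)) -/M lad.
have -> : relative_sign (phi y) (phi x) = b.
  apply: relative_signP; apply: step_closeW byx.
  by rewrite ge_min; apply/orP; right; lra.
rewrite flip0 -[_ + b]/(_ (+) b) -flip_flip; apply: step_close_flip.
have := step_close_flip b byx; rewrite flipK; apply: step_closeW.
by rewrite ge_min lexx.
Qed.
End Contraction.
End Lifting.

(** A locally constant sign is a continuous family of constant step functions, so [contraction_tube]
    provides steps along which it cannot change on the way to [x0]. *)
Lemma contractible_const (R : realType) (T : topologicalType) (c : T -> bool) :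
  contractible R T -> (forall x, \forall y \near x, c y = c x) ->
  forall x y, c x = c y.
Proof.
move=> [x0 [H [Hc H0 H1]]] cc.
have cphi : sign_continuous 0 (fun x (_ : R) (_ : unit) => c x).
  move=> x e e0; apply: filterS (cc x) => y ->; exists false => //.
  exact: step_close_refl.
suff cx0 x : c x = c x0 by move=> x y; rewrite !cx0.
have e8 : 0 < 1 / 8 :> R by lra.
have [N /nbhs_singleton tN] := contraction_tube cphi Hc x e8.
have cdyadic k : (k <= 2 ^ N)%N -> c (H (x, dyadic R N k)) = c x.
  elim: k => [_|k IH kN]; first by rewrite dyadic0 H0.
  rewrite -IH 1?ltnW //.
  have [|||b b2 /=] := tN (dyadic R N k) (dyadic R N k.+1).
  - by rewrite dyadic01 // ltnW.
  - exact: dyadic01.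
  - exact: dyadic_step.
  have -> : b = false by case: b b2 => // /(_ isT).
  pose F := fun (_ : R) (_ : unit) => false; move=> /(step_closeW (e' := 1)) cl.
  have cflip z : (fun (_ : R) (_ : unit) => c z) = flip (c z) F.
    by apply/funext => u; apply/funext => j; rewrite /flip addbF.
  move: cl; rewrite flip0 !cflip => cl; apply: (step_close_flip_inj tt).
  by apply: cl; lra.
by rewrite -(cdyadic (2 ^ N)%N) // dyadic_top H1.
Qed.

(** The ratio is locally constant: if it jumped while [A] and [B] move little, [B x] would be close
    to its opposite. *)
Lemma sign_ratio_const (R : realType) (T : topologicalType)
    (A B : T -> R -> unit -> bool) :
  contractible R T -> sign_continuous 0 A -> sign_continuous 0 B ->
  (forall x, exists b : bool, forall u, 0 <= u < 1 -> A x u tt = b (+) B x u tt) ->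
  exists b : bool, forall x u, 0 <= u < 1 -> A x u tt = b (+) B x u tt.
Proof.
move=> cT cA cB AB; pose b x := sval (cid (AB x)).
have bP x := svalP (cid (AB x)); have [x0 _] := cT.
exists (b x0) => x u u01; rewrite (contractible_const cT _ x0 x); first exact: bP.
move=> {u u01} x; have e8 : 0 < 1 / 8 :> R by lra.
have near0 (F : T -> R -> unit -> bool) : sign_continuous 0 F ->
    \forall y \near x, step_close (1 / 8) (F y) (F x).
  move=> cF; apply: filterS (cF x _ e8) => y [c c2].
  by have -> : c = false by case: c c2 => // /(_ isT).
apply: filterS2 (near0 _ cA) (near0 _ cB) => y Ay By.
have AE z e : 0 < e -> step_close e (A z) (flip (b z) (B z)).
  move=> e0; apply: small_sub (small0 e0) => u [u01]; apply.
  by apply/funext => -[]; exact: bP.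
apply: (step_close_flip_inj tt (F := B x)).
(* Four distances of 1/8 add up to 1/2, below the threshold 1 of [step_close_flip_inj]. *)
have yx := step_close_trans (step_close_sym (step_close_flip (b y) By))
  (step_close_trans (step_close_sym (AE y _ e8)) (step_close_trans Ay (AE x _ e8))).
by apply: step_closeW yx; lra.
Qed.

(** * Grafting from arity two into arity four *)

Lemma cg_kify_continuous (S T : topologicalType) (g : S -> T) :
  compactly_generated S -> continuous g -> continuous (g : S -> kify T).
Proof.
move=> cgS cg; apply/continuousP => U; rewrite {1}/open /= => kU.
apply: cgS => K f cK hK cf; rewrite -comp_preimage; apply: kU => //.
by move=> k; apply: continuous_comp; [exact: cf|exact: cg].
Qed.

Lemma any_arity_inj (O : operad_data) n (x y : O n) :
  any_arity x = any_arity y -> x = y.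
Proof. exact: (Eqdep_dec.inj_pair2_eq_dec _ PeanoNat.Nat.eq_dec). Qed.

Lemma I2P (j : 'I_2) : {j = ord0} + {j = ord_max}.
Proof. by case: j => -[|[|//]] lj; [left|right]; apply: val_inj. Qed.

Section Commutation.
Variable C : operad_data.
Hypothesis C_operad : is_operad C.

Let tau : 'S_2 := tperm ord0 ord_max.
Let cyc : 'S_4 := perm (@ordS_inj 4).

(** The same [y] is grafted twice, so that exchanging the inputs of [x] amounts to a relabelling and
    the sign function of [y] cancels. *)
Definition branch (y x : C 1) : C 3 :=
  ocomp (ocomp x ord0 y) (@outer 1 1 ord0 ord_max) y.

(** Exchanging the inputs of [x] exchanges the blocks 0, 1 and 2, 3 of inputs, and this block
    exchange is the square of the four-cycle. *)
Lemma branch_swap (y x : C 1) :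
  branch y (oact x tau) = oact (oact (branch y x) cyc) cyc.
Proof.
have [i1 i1E] : {i : 'I_3 | i = 1%N :> nat} by exists (inord 1); rewrite inordK.
have o0 : @outer 1 1 ord_max ord0 = ord0 by apply: val_inj; rewrite /= inordK.
have o1 : @outer 1 1 ord0 ord_max = ord_max by apply: val_inj; rewrite /= inordK.
(* The exchange after one grafting: the block 1, 2 moves to 0, 1 and the single input 0 to 2. *)
pose r : 'S_3 := (tperm ord0 i1 * tperm i1 ord_max)%g.
have i10 : i1 != ord0 by rewrite -val_eqE /= i1E.
have i12 : i1 != ord_max by rewrite -val_eqE /= i1E.
have r0 : r ord0 = ord_max by rewrite permM !tpermL.
have r1 : r i1 = ord0 by rewrite permM tpermR tpermD.
have r2 : r ord_max = i1 by rewrite permM (@tpermD _ ord0 i1 ord_max) ?tpermR.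
have E1 : ocomp (oact x tau) ord0 y = oact (ocomp x ord_max y) r.
  have := ocomp_equivariant C_operad x y (i := ord_max) (s := tau) (t := 1%g) (r := r).
  rewrite tpermR (oact1 C_operad); apply => [j|c c1].
    rewrite perm1; have [->|->] := I2P j.
      have -> : @inner 1 1 ord_max ord0 = i1 by apply: val_inj; rewrite /= inordK.
      by rewrite r1; apply: val_inj; rewrite /= inordK.
    have -> : @inner 1 1 ord_max ord_max = ord_max by apply: val_inj; rewrite /= inordK.
    by rewrite r2; apply: val_inj; rewrite /= inordK.
  have -> : c = ord0 by have [//|cE] := I2P c; rewrite cE eqxx in c1.
  by rewrite tpermL o0 o1.
have E2 : ocomp (oact (ocomp x ord_max y) r) (ord_max : 'I_3) y =
    oact (oact (ocomp (ocomp x ord_max y) (ord0 : 'I_3) y) cyc) cyc :> C 3.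
  rewrite -(oactM C_operad).
  have := ocomp_equivariant C_operad (ocomp x ord_max y) y
    (i := ord0) (s := r) (t := 1%g) (r := (cyc * cyc)%g).
  rewrite r0 (oact1 C_operad); apply => [j|c c1].
    rewrite perm1 permM !permE; have [->|->] := I2P j; apply: val_inj.
      by rewrite /= !inordK.
    by rewrite /= !inordK.
  have [cE|cE] : c = i1 \/ c = ord_max.
    case: c c1 => -[|[|[|//]]] lc c1 //; [left|right]; apply: val_inj => //.
  - rewrite cE r1 permM !permE; apply: val_inj.
    by rewrite /outer /= i1E !inordK.
  - rewrite cE r2 permM !permE; apply: val_inj.
    by rewrite /outer /= i1E !inordK.
(* The two copies of [y] sit at different inputs of [x], so they may be grafted in either order. *)
have E3 : ocomp (ocomp x ord_max y) (ord0 : 'I_3) y = branch y x :> C 3.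
  apply: any_arity_inj; have := @ocomp_par C C_operad 1 1 1 x y y ord_max ord0 isT.
  by rewrite o0.
by rewrite /branch o1 E1 E2 E3 /branch o1.
Qed.
End Commutation.

(** Composition is continuous on the compactly generated product, so pairing with a fixed operation
    must be continuous into that finer topology, by [cg_kify_continuous]. *)
Lemma branch_continuous (C : operad_data) (y : C 1) : is_operad C ->
  continuous (branch y).
Proof.
move=> opC.
have pairc n m (z : C m) : continuous (fun x : C n => (x, z) : kpair (C n) (C m)).
  apply: cg_kify_continuous; first exact: op_cg.
  by move=> x; apply: cvg_pair; [exact: cvg_id|exact: cvg_cst].
have compc n m (i : 'I_n.+1) (z : C m) : continuous (fun x : C n => ocomp x i z).
  move=> x; exact: (continuous_comp (@pairc n m z x) (@ocomp_continuous _ opC n m i _)).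
move=> x; exact: (continuous_comp (@compc 1 1 ord0 y x)
  (@compc 2 1 (@outer 1 1 ord0 ord_max) y _))%N.
Qed.

Theorem theorem19 (R : realType) :
  ~ exists C : operad_data, is_Einfty_operad R C /\
      exists f : forall n : nat, C n -> Xi R n, is_operad_morphism f.
Proof.
move=> [C [[opC cC _] [f mf]]].
pose step n (x : C n) := Xi_step (f n x).
have cstep n : sign_continuous n (step n).
  apply: (sign_continuous_comp (f := f n)); first exact: omor_continuous mf n.
  exact: Xi_step_continuous.
have [chi cPhi] : exists chi : C 3 -> bool,
    sign_continuous 0 (fun x => flip (chi x) (step 3 x)).
  have [x0 [H [Hc H0 H1]]] := cC 3.
  exact: (sign_lift tt (cstep 3) Hc H0 H1).
have step_comp n m (x : C n) (i : 'I_n.+1) (y : C m) : exists b : bool,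
    forall u, 0 <= u < 1 ->
    step (n + m)%N (ocomp x i y) u tt = b + (step n x u tt + step m y u tt).
  have [b bE] := Xi_comp_step (f n x) i (f m y); exists b => u u01.
  by rewrite -bE // /step (omor_comp mf).
pose Phi x := flip (chi x) (step 3 x).
pose tau : 'S_2 := tperm ord0 ord_max; pose cyc : 'S_4 := perm (@ordS_inj 4).
have [[y _] [x _]] := (cC 1, cC 1).
have [b Phib] : exists b : bool, forall z u, 0 <= u < 1 ->
    Phi (oact z cyc) u tt = b (+) Phi z u tt.
  apply: (sign_ratio_const (A := fun z => Phi (oact z cyc))
    (B := Phi) (cC 3) _ cPhi).
    exact: (sign_continuous_comp (@oact_continuous _ opC 3 _) cPhi).
  move=> z; have [c _ cE] := Xi_act_step (f 3 z) cyc.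
  exists (chi (oact z cyc) (+)
    (c (+) (tree_sign (corolla cyc) (+) chi z))).
  move=> u u01; rewrite /Phi /flip /step (omor_act mf) cE // -[_ + _]/(_ (+) _).
  by rewrite -!addbA; do 4!congr (_ (+) _); rewrite addbA addbb.
have [k Phik] : exists b : bool, forall z u, 0 <= u < 1 ->
    Phi (branch y z) u tt = b (+) step 1 z u tt.
  apply: (sign_ratio_const (A := fun z => Phi (branch y z)) (B := step 1%N) (cC 1)).
  - exact: (sign_continuous_comp (@branch_continuous C y opC) cPhi).
  (* [2 <= 1] and [2 <= 0] are both false, so in arity two the signs are continuous without any
     lift. *)
  - by move=> z e e0; apply: filterS (cstep 1%N z e e0) => z' [c c2 zz]; exists c.
  - move=> z; have [c cE] := step_comp _ _ z ord0 y.
    have [d dE] := step_comp _ _ (ocomp z ord0 y) (@outer 1 1 ord0 ord_max) y.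
    exists (chi (branch y z) + (d + c)) => u u01.
    have sE : step 3%N (branch y z) u tt =
        d + (c + (step 1%N z u tt + step 1%N y u tt) + step 1%N y u tt).
      by apply: etrans (dE u u01) _; congr (d + (_ + _)); exact: cE.
    (* The step function of [y] occurs twice and cancels; only constants and that of [z] remain. *)
    rewrite /Phi /flip sE -!addrA addbool addr0 -![_ (+) _]/(_ + _).
    by rewrite -!addrA.
have u01 : 0 <= (0 : R) < 1 by rewrite lexx ltr01.
have := Phik (oact x tau) 0 u01.
(* The sign [b] of the four-cycle, the same for all points, enters twice. *)
rewrite (branch_swap opC) !Phib // addbA addbb addFb Phik //.
have [c c2 cE] := Xi_act_step (f 1 x) tau.
rewrite /step (omor_act mf) cE // tree_sign_tau.
(* Degree one admits no ambiguity, so the transposition acts by -1 exactly. *)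
have -> : c = false by case: c c2 {cE} => // /(_ isT).
by case: k (Xi_step _ _ _) {Phik} => [] [].
Qed.
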